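(* Consider any problem instance, any optimal solution $x^*$ of the linear program (LP) of the context, and the Refined Large-or-Small algorithm ($RLS$) run with $x^*$. For each resource $j\in[m]$, the expected amount of resource $j$ allocated to customers by $RLS$ is at least $r^*U_j$.
   Context: Model. Write $[k]=\{1,\dots,k\}$. A problem instance consists of a horizon $[0,T]$; $m$ resources, resource $j\in[m]$ having capacity $c_j>0$; $n$ customer types, where customers of type $i\in[n]$ arrive according to a non-homogeneous Poisson process with known rate $\lambda_i(t)$, $t\in[0,T]$, and finite expected number of arrivals $\Lambda_i=\int_0^T\lambda_i(t)\,dt$ (the processes of different types are independent); and known numbers $u_{ij}\in[0,c_j]$. When a customer arrives, it must immediately and irrevocably be assigned to one of the resources or rejected. Assigning a type-$i$ customer to resource $j$ consumes exactly $u_{ij}$ units of resource $j$ (allowed only if at least $u_{ij}$ units of $j$ remain). (LP): maximize $\sum_{i\in[n]}\sum_{j\in[m]}x_{ij}u_{ij}$ subject to $\sum_{i}x_{ij}u_{ij}\le c_j$ for all $j$, $\sum_j x_{ij}\le\Lambda_i$ for all $i$, and $x_{ij}\ge0$. Constants. Let $$h(z,r)= z-\Big[z-\tfrac12\Big(1-\tfrac{1}{1-2r}\cdot\tfrac1{e^2}\Big)\Big](1-2r)\Big(\tfrac{1-z}{1-z-r}\Big)^{2(1-z)},$$ $$r^*=\max\Big\{r\in(0,0.5): r\le\max_{z\in(0,0.5)}h(z,r)\Big\}\approx0.321,\qquad z^*=\arg\max_{z\in(0,0.5)}h(z,r^* )\approx0.42$$ (the maximizer is unique). Sets and loads. For each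 resource $j$: $L_j=\{i:u_{ij}>c_j/2\}$, $S_j=[n]\setminus L_j$, $M_j=\{i\in S_j:u_{ij}\ge z^*c_j\}$, $T_j=\{i\in S_j:u_{ij}<z^*c_j\}$. Given an optimal solution $x^*$ of (LP), $U_j=\sum_{i\in[n]}x^*_{ij}u_{ij}$, $U_j^S=\sum_{i\in S_j}x^*_{ij}u_{ij}$, $U_j^T=\sum_{i\in T_j}x^*_{ij}u_{ij}$. Resource $j$ is of type A if $U_j^S\ge-0.5c_j\log(1-2r^*U_j/c_j)$ or $U_j^T\ge-(1-z^* )c_j\log\big(1-\frac{r^*U_j}{c_j(1-z^* )}\big)$; otherwise it is of type B. A customer of type $i$ is admissible to resource $j$ iff resource $j$ is of type A or $i\in M_j\cup L_j$. Algorithm $RLS$. (1) Solve (LP) to get $x^*$. (2) Random routing: upon arrival of a type-$i$ customer, independently of everything else, pick at random a resource, resource $j$ being picked with probability $x^*_{ij}/\Lambda_i$ (with the remaining probability none is picked, and the customer is treated as rejected in step (3)); the customer is said to be routed to the picked resource. (3) Admission: if the customer is admissible to the picked resource $j$ and the remaining capacity of $j$ is at least $u_{ij}$, assign the customer to $j$. (4) Resource sharing: if the customer is rejected in step (3) but there is another resource with enough remaining capacity to which the customer is admissible, assign the customer to any such resource; otherwise reject the customer. *)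

(* Defs.v *)
From HB Require Import structures.
From mathcomp Require Import all_boot all_order all_algebra.
From mathcomp Require Import all_classical all_reals all_analysis.

Set Implicit Arguments.
Unset Strict Implicit.
Unset Printing Implicit Defensive.

Import Order.TTheory GRing.Theory Num.Theory.
Import numFieldNormedType.Exports.

Local Open Scope classical_set_scope.
Local Open Scope ring_scope.

Record instance (R : realType) (m n : nat) := Instance {
  horizon : R;
  capacity : 'I_m -> R;
  rate : 'I_n -> R -> R;
  usage : 'I_n -> 'I_m -> R;
  horizon_ge0 : 0 <= horizon;
  capacity_gt0 : forall j, 0 < capacity j;
  rate_ge0 : forall i t, 0 <= t <= horizon -> 0 <= rate i t;
  rate_integrable : forall i,
    (@lebesgue_measure R).-integrable `[0, horizon] (EFin \o rate i);
  usage_bounds : forall i j, 0 <= usage i j <= capacity j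
}.

Section linear_program.
Context (R : realType) (m n : nat) (I : instance R m n).
Implicit Type x : 'I_n -> 'I_m -> R.

Definition mean_arrivals (i : 'I_n) (B : set R) : R :=
  \int[@lebesgue_measure R]_(t in B) rate I i t.

Definition Lambda (i : 'I_n) : R := mean_arrivals i `[0, horizon I].

Definition LP_objective x : R := \sum_i \sum_j x i j * usage I i j.

Definition LP_feasible x : Prop :=
  [/\ forall j, \sum_i x i j * usage I i j <= capacity I j,
      forall i, \sum_j x i j <= Lambda i
    & forall i j, 0 <= x i j].

Definition LP_optimal x : Prop :=
  LP_feasible x /\ forall y, LP_feasible y -> LP_objective y <= LP_objective x.

End linear_program.

Section constants.
Context (R : realType).
Implicit Types (A : set R) (r z : R).

Definition is_max A r : Prop := A r /\ ubound A r.

Definition h z r : R :=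
  z - (z - 2^-1 * (1 - (1 - 2 * r)^-1 * (expR 2)^-1)) * (1 - 2 * r)
      * ((1 - z) / (1 - z - r)) `^ (2 * (1 - z)).

Definition is_rstar r : Prop :=
  is_max [set r' | 0 < r' < 2^-1 /\
            exists2 v, is_max [set h z r' | z in `]0, 2^-1[] v & r' <= v] r.

Definition is_zstar r z : Prop :=
  0 < z < 2^-1 /\ forall z', 0 < z' < 2^-1 -> h z' r <= h z r.

End constants.

Section resource_types.
Context (R : realType) (m n : nat) (I : instance R m n).
Context (r z : R) (x : 'I_n -> 'I_m -> R).
Implicit Types (i : 'I_n) (j : 'I_m).

Local Notation c := (capacity I).
Local Notation u := (usage I).

Definition large j : {set 'I_n} := [set i | c j / 2 < u i j].
Definition small j : {set 'I_n} := ~: large j.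
Definition medium j : {set 'I_n} := [set i in small j | z * c j <= u i j].
Definition tiny j : {set 'I_n} := [set i in small j | u i j < z * c j].

Definition load_on (A : {set 'I_n}) j : R := \sum_(i in A) x i j * u i j.

Definition U j : R := load_on [set: 'I_n] j.
Definition US j : R := load_on (small j) j.
Definition UT j : R := load_on (tiny j) j.

Definition type_A j : bool :=
  (US j >= - 2^-1 * c j * ln (1 - 2 * r * U j / c j)) ||
  (UT j >= - (1 - z) * c j * ln (1 - r * U j / (c j * (1 - z)))).

Definition admissible i j : bool := type_A j || (i \in medium j :|: large j).

End resource_types.

(* The resource to which a customer is routed is part of the customer's data;
   None means that the random routing picked no resource. *)
Record customer (R : realType) (m n : nat) := Customer {
  arrival_time : R;
  customer_type : 'I_n;
  routed_to : option 'I_m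
}.

Definition customers (R : realType) (m n k : nat) (t : k.-tuple R)
    (s : k.-tuple 'I_n) (o : k.-tuple (option 'I_m)) : seq (customer R m n) :=
  [seq Customer (tnth t l) (tnth s l) (tnth o l) | l <- enum 'I_k].

Section stochastic_model.
Context (R : realType) (m n : nat) (I : instance R m n).
Context (x : 'I_n -> 'I_m -> R).

Definition route_prob (i : 'I_n) (o : option 'I_m) : R :=
  if o is Some j then x i j / Lambda I i
  else 1 - \sum_j x i j / Lambda I i.

Context d (Omega : measurableType d) (P : probability Omega R).
(* X w is the list of all customers of the realization w, in order of arrival. *)
Implicit Type X : Omega -> seq (customer R m n).

Definition arrivals_ordered X : Prop := forall w,
  sorted (fun a b : customer R m n => arrival_time a < arrival_time b) (X w) /\
  all (fun a : customer R m n => 0 <= arrival_time a <= horizon I) (X w).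

Definition stream_event X k (B : set (k.-tuple R)) (s : k.-tuple 'I_n)
    (o : k.-tuple (option 'I_m)) : set Omega :=
  [set w | exists2 t, B t & X w = customers t s o].

Definition arrival_event X k (B : set (k.-tuple R)) (s : k.-tuple 'I_n) :
    set Omega :=
  [set w | exists o, stream_event X B s o w].

Definition stream_measurable X : Prop :=
  forall k (B : set (k.-tuple R)) s o,
    measurable B -> measurable (stream_event X B s o).

Definition count_arrivals (s : seq (customer R m n)) (i : 'I_n) (B : set R) :
    nat :=
  count (fun a => (customer_type a == i) && (arrival_time a \in B)) s.

(* The library's poisson_pmf is 1 at rate 0; with 0 ^+ 0 = 1 the following is
   the Dirac mass at 0, as needed when a type has no arrivals in a set. *)
Definition poisson_mass (mu : R) (k : nat) : R :=
  expR (- mu) * mu ^+ k / k`!%:R.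

(* The numbers of arrivals of the various types in disjoint Borel sets are
   mutually independent Poisson variables whose means are the integrals of the
   rates. Taking q families of increments at once expresses that each type is a
   non-homogeneous Poisson process and that the types are independent. *)
Definition poisson_arrivals X : Prop :=
  forall q (B : 'I_q -> set R) (k : 'I_n -> 'I_q -> nat),
    (forall l, measurable (B l)) ->
    (forall l, B l `<=` `[0, horizon I]) ->
    trivIset setT B ->
    P [set w | forall i l, count_arrivals (X w) i (B l) = k i l] =
    (\prod_i \prod_l poisson_mass (mean_arrivals I i (B l)) (k i l))%:E.

(* Given the arrival times and types, and the random seed available to the
   sharing step, the routing choices are independent with law route_prob; the
   seed is independent of the customer stream. *)
Definition routing_independent X d' (Z : measurableType d')
    (seed : Omega -> Z) : Prop :=
  forall k (B : set (k.-tuple R)) (s : k.-tuple 'I_n)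
      (o : k.-tuple (option 'I_m)) (C : set Z),
    measurable B -> measurable C ->
    P (stream_event X B s o `&` seed @^-1` C) =
    (P (arrival_event X B s)
     * (\prod_l route_prob (tnth s l) (tnth o l))%:E
     * P (seed @^-1` C))%E.

End stochastic_model.

Section algorithm.
Context (R : realType) (m n : nat) (I : instance R m n).
Context (r z : R) (x : 'I_n -> 'I_m -> R).
Context d' (Z : measurableType d').

(* A sharing rule chooses an element of the given nonempty set of resources. It
   may use a random seed and the history up to and including the current
   customer, but not the future arrivals. Past assignments need not be passed:
   they are determined by the seed and the history. *)
Definition sharing_rule := Z -> seq (customer R m n) -> {set 'I_m} -> 'I_m.

Definition sharing_rule_valid (share : sharing_rule) : Prop :=
  forall zeta hist A, A != finset.set0 -> share zeta hist A \in A.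

Definition sharing_rule_measurable (share : sharing_rule) : Prop :=
  forall k (s : k.-tuple 'I_n) (o : k.-tuple (option 'I_m)) A j,
    measurable
      [set y : Z * k.-tuple R | share y.1 (customers y.2 s o) A = j].

Variables (share : sharing_rule) (zeta : Z).
Implicit Types (used : {ffun 'I_m -> R}) (hist : seq (customer R m n)).

Definition can_take used (i : 'I_n) (j : 'I_m) : bool :=
  admissible I r z x i j && (usage I i j <= capacity I j - used j).

(* hist contains the current customer a as its last element. *)
Definition assigned_to used hist (a : customer R m n) : option 'I_m :=
  let i := customer_type a in
  let shared :=
    let E := [set j | can_take used i j & Some j != routed_to a]%SET in
    if E != finset.set0 then Some (share zeta hist E) else None in
  if routed_to a is Some j then
    if can_take used i j then Some j else shared
  else shared.

Definition allocate used (i : 'I_n) (dest : option 'I_m) : {ffun 'I_m -> R} :=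
  [ffun j => used j + (if dest == Some j then usage I i j else 0)].

Fixpoint RLS_from used hist (s : seq (customer R m n)) : {ffun 'I_m -> R} :=
  if s is a :: s' then
    let hist' := rcons hist a in
    RLS_from (allocate used (customer_type a) (assigned_to used hist' a))
      hist' s'
  else used.

Definition RLS (s : seq (customer R m n)) : {ffun 'I_m -> R} :=
  RLS_from [ffun=> 0] [::] s.

End algorithm.

(* Main.v *)
From HB Require Import structures.
Require Import Defs.
From mathcomp Require Import all_boot all_order all_algebra.
From mathcomp Require Import all_classical all_reals all_analysis.
From mathcomp Require Import measurable_realfun.
From mathcomp Require Import ring lra.

Set Implicit Arguments.
Unset Strict Implicit.
Unset Printing Implicit Defensive.

Import Order.TTheory GRing.Theory Num.Theory.
Import numFieldNormedType.Exports.

Local Open Scope classical_set_scope.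
Local Open Scope ring_scope.

(** Fix a resource j of capacity c and follow the amount in use over time. It
    never decreases, whatever the sharing step does, and the theorem rests on how
    fast its expectation must grow.

    Cut the horizon into windows, each with at most [delta] expected arrivals
    ([fine_partition]). The algorithm and the sharing rule do not see the future:
    the event that the next window contains exactly one customer, of type i and
    routed to j, is independent of the seed and of all customers up to the start
    of the window ([past_event_independent]). Its probability is at least
    [expR (- delta)] times the mean number of such customers. Windows with several
    arrivals only cost the factor [expR (- delta)], which tends to 1. Hence a
    function of the use that never decreases along the process gains in
    expectation at least what a single routed customer brings ([process_step]).

    Type A. Customers of size at most c - b are accepted while at most b is in
    use, which by Markov's inequality has probability at least one minus the
    expected use over b. If V is the load of such customers, the expected use is
    at least b (1 - exp (- V / b)) ([allocation_fill_limit]). For the small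
    customers take b = c / 2, for the tiny ones b = (1 - z) c; the conditions that
    define type A say that this is at least r U.

    Type B. Only medium and large customers enter, so the use is 0 or at least
    z c. Give an unused resource a value V <= z c; the use plus this value does
    not decrease, even if sharing brings the first customer. Going backwards
    through the windows, routed medium customers let V grow towards z c and large
    ones towards c / 2, at rates twice their load since the sizes of medium
    customers are at most c / 2 and those of large ones more than c / 2
    ([allocation_stop_limit]). With y = U / c the resulting bound is smallest
    when the loads of small and of tiny customers sit at the thresholds of type A,
    and then it must be compared with r y ([large_small_bound]). For y = 1 the
    comparison is r <= h z r. The general case reduces to this one because the
    difference, multiplied by exp (2 y), first increases and then decreases on
    [0, 1] and vanishes at y = 0 ([gap_ge]). Two consequences of the choice of the
    constants are used there: r <= z, because at the maximum the bracket of [h] is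
    nonnegative ([zstar_ge]), and r <= 1 / 3 ([rstar_le_third]). *)

(** * Lists of customers and tuples of times *)

Section customer_lists.
Context (R : realType) (m n : nat).
Local Notation cust := (customer R m n).
Implicit Types (c : seq cust) (tau : R).

Definition earlier (a b : cust) : bool := arrival_time a < arrival_time b.

Definition upto tau c := [seq a <- c | arrival_time a <= tau].

Definition after tau c := [seq a <- c | tau < arrival_time a].

Lemma earlier_trans : transitive earlier.
Proof. by move=> b a c; exact: lt_trans. Qed.

Lemma filter_none (T : Type) (p : pred T) (s : seq T) :
  all (predC p) s -> [seq x <- s | p x] = [::].
Proof.
rewrite all_predC -size_filter_gt0 => ps; apply: size0nil.
by apply/eqP; rewrite -leqn0 leqNgt.
Qed.

Lemma upto_cat c1 c2 tau : all (fun a => arrival_time a <= tau) c1 ->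
  all (fun a => tau < arrival_time a) c2 -> upto tau (c1 ++ c2) = c1.
Proof.
move=> h1 h2; rewrite /upto filter_cat (all_filterP h1) filter_none ?cats0 //.
by apply: sub_all h2 => a /=; rewrite ltNge.
Qed.

(** Arrival times are strictly increasing, so discarding the customers after a
    given time cuts the list in two pieces. *)
Lemma upto_after tau c : sorted earlier c -> c = upto tau c ++ after tau c.
Proof.
elim: c => //= a c IH ac.
have sc : sorted earlier c by exact: path_sorted ac.
case: (leP (arrival_time a) tau) => ta /=; first by rewrite -IH.
have all_gt : all (fun b => tau < arrival_time b) c.
  move: ac; rewrite (path_sortedE earlier_trans) => /andP[+ _].
  by apply: sub_all => b; exact: lt_trans.
rewrite /upto filter_none ?cat0s /after ?(all_filterP all_gt) //.
by apply: sub_all all_gt => b /=; rewrite ltNge.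
Qed.

Lemma upto_upto tau tau' c : tau <= tau' -> upto tau (upto tau' c) = upto tau c.
Proof.
move=> tt; rewrite /upto -filter_predI; apply: eq_filter => a /=.
by case: leP => // /le_trans ->.
Qed.

Lemma sorted_upto tau c : sorted earlier c -> sorted earlier (upto tau c).
Proof. by apply: sorted_filter; exact: earlier_trans. Qed.

Lemma all_upto tau c : all (fun a => arrival_time a <= tau) (upto tau c).
Proof. exact: filter_all. Qed.

Section coordinates.
Context (k : nat) (t : k.-tuple R) (s : k.-tuple 'I_n) (o : k.-tuple (option 'I_m)).

Lemma size_customers : size (customers t s o) = k.
Proof. by rewrite size_map size_enum_ord. Qed.

Lemma map_arrival_time : map (@arrival_time R m n) (customers t s o) = t.
Proof. by rewrite -map_comp -[RHS]map_tnth_enum. Qed.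

Lemma map_customer_type : map (@customer_type R m n) (customers t s o) = s.
Proof. by rewrite -map_comp -[RHS]map_tnth_enum. Qed.

Lemma map_routed_to : map (@routed_to R m n) (customers t s o) = o.
Proof. by rewrite -map_comp -[RHS]map_tnth_enum. Qed.

End coordinates.

Lemma customer_list_eq c c' :
  map (@arrival_time R m n) c = map (@arrival_time R m n) c' ->
  map (@customer_type R m n) c = map (@customer_type R m n) c' ->
  map (@routed_to R m n) c = map (@routed_to R m n) c' -> c = c'.
Proof.
elim: c c' => [|[a1 a2 a3] c IH] [|[b1 b2 b3] c'] //= [-> et] [-> es] [-> eo].
by rewrite (IH c').
Qed.

Lemma customers_inj k (t t' : k.-tuple R) (s s' : k.-tuple 'I_n)
    (o o' : k.-tuple (option 'I_m)) :
  customers t s o = customers t' s' o' -> [/\ t = t', s = s' & o = o'].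
Proof.
move=> e; split; apply/val_inj => /=.
- by rewrite -(map_arrival_time t s o) e map_arrival_time.
- by rewrite -(map_customer_type t s o) e map_customer_type.
- by rewrite -(map_routed_to t s o) e map_routed_to.
Qed.

Lemma customers_size_eq k k' (t : k.-tuple R) (t' : k'.-tuple R) s s' o o' :
  customers t s o = customers t' s' o' :> seq cust -> k = k'.
Proof. by move/(congr1 size); rewrite !size_customers. Qed.

Definition times c := map_tuple (@arrival_time R m n) (in_tuple c).
Definition types c := map_tuple (@customer_type R m n) (in_tuple c).
Definition routes c := map_tuple (@routed_to R m n) (in_tuple c).

(** Every realization is of the form [customers t s o]. This is what allows an
    arbitrary event to be split according to the number of customers, their
    types and their routes, leaving only the times as a continuous variable. *)
Lemma customers_eta c : customers (times c) (types c) (routes c) = c.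
Proof.
by apply: customer_list_eq;
  rewrite ?map_arrival_time ?map_customer_type ?map_routed_to.
Qed.

Lemma customersP k c : size c = k ->
  exists (t : k.-tuple R) s o, c = customers t s o.
Proof. by move=> <-; exists (times c), (types c), (routes c); rewrite customers_eta. Qed.

Lemma customers_cat k l (t : k.-tuple R) (t' : l.-tuple R)
    (s : k.-tuple 'I_n) (s' : l.-tuple 'I_n)
    (o : k.-tuple (option 'I_m)) (o' : l.-tuple (option 'I_m)) :
  customers [tuple of t ++ t'] [tuple of s ++ s'] [tuple of o ++ o'] =
  customers t s o ++ customers t' s' o' :> seq cust.
Proof.
by apply: customer_list_eq; rewrite map_cat
  ?map_arrival_time ?map_customer_type ?map_routed_to.
Qed.

Lemma all_customers_time (p : pred R) k (t : k.-tuple R)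
    (s : k.-tuple 'I_n) (o : k.-tuple (option 'I_m)) :
  all (fun a : cust => p (arrival_time a)) (customers t s o) = all p t.
Proof. by rewrite -[in RHS](map_arrival_time t s o) all_map. Qed.

End customer_lists.

Section tuple_split.
Context (T : Type) (k l : nat).

Definition tleft (t : (k + l).-tuple T) : k.-tuple T :=
  [tuple tnth t (lshift l a) | a < k].

Definition tright (t : (k + l).-tuple T) : l.-tuple T :=
  [tuple tnth t (rshift k a) | a < l].

Lemma tleftK (t : k.-tuple T) (t' : l.-tuple T) : tleft [tuple of t ++ t'] = t.
Proof. by apply: eq_from_tnth => a; rewrite tnth_mktuple tnth_lshift. Qed.

Lemma trightK (t : k.-tuple T) (t' : l.-tuple T) : tright [tuple of t ++ t'] = t'.
Proof. by apply: eq_from_tnth => a; rewrite tnth_mktuple tnth_rshift. Qed.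

Lemma tsplitK (t : (k + l).-tuple T) : [tuple of tleft t ++ tright t] = t.
Proof.
apply: eq_from_tnth => a; rewrite -(splitK a); case: (fintype.split a) => b /=.
  by rewrite tnth_lshift tnth_mktuple.
by rewrite tnth_rshift tnth_mktuple.
Qed.

End tuple_split.

Section tuple_measurability.
Context d (T : measurableType d) (k l : nat).

Lemma measurable_tleft : measurable_fun setT (@tleft T k l).
Proof.
apply/measurable_fun_tnthP => a.
rewrite (_ : _ \o _ = @tnth _ T ^~ (lshift l a)); first exact: measurable_tnth.
by apply/funext => t /=; rewrite tnth_mktuple.
Qed.

Lemma measurable_tright : measurable_fun setT (@tright T k l).
Proof.
apply/measurable_fun_tnthP => a.
rewrite (_ : _ \o _ = @tnth _ T ^~ (rshift k a)); first exact: measurable_tnth.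
by apply/funext => t /=; rewrite tnth_mktuple.
Qed.

Lemma measurable_all_tuple (A : 'I_k -> set T) :
  (forall a, measurable (A a)) ->
  measurable [set t : k.-tuple T | forall a, A a (tnth t a)].
Proof.
move=> mA.
rewrite (_ : mkset _ = \bigcap_(a in [set: 'I_k]) ((@tnth _ T ^~ a) @^-1` A a)).
  apply: fin_bigcap_measurable; first exact: finite_finset.
  by move=> a _; rewrite -[X in measurable X]setTI; exact: measurable_tnth.
by apply/seteqP; split=> t /= h a; [move=> _; exact: h|exact: (h a I)].
Qed.

End tuple_measurability.

Section finite_additivity.
Context d (Omega : measurableType d) (R : realType) (P : {measure set Omega -> \bar R}).

Lemma measure_fin_union (T : finType) (G : T -> set Omega) :
  (forall a, measurable (G a)) -> trivIset setT G ->
  P (\bigcup_a G a) = (\sum_a P (G a))%E.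
Proof.
move=> mG tG; rewrite measure_fin_bigcup //; last exact: finite_finset.
rewrite (fsbig_seq _ _ (index_enum_uniq T)); apply: eq_fsbigl.
by apply/seteqP; split => a //= _; rewrite mem_index_enum.
Qed.

Lemma fin_union_measurable (T : finType) (G : T -> set Omega) :
  (forall a, measurable (G a)) -> measurable (\bigcup_a G a).
Proof.
by move=> mG; apply: fin_bigcup_measurable => //; exact: finite_finset.
Qed.

End finite_additivity.

(** * The stream stopped at a given time *)

Section routing_law.
Context (R : realType) (m n : nat) (I : instance R m n).
Context (x : 'I_n -> 'I_m -> R).

Lemma sum_route_prob i : \sum_o route_prob I x i o = 1.
Proof.
rewrite (bigD1 None) //= (reindex_omap Some id) /=; last by case.
rewrite [X in _ + X](eq_bigl xpredT) ?subrK //.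
by move=> j /=; rewrite eqxx.
Qed.

(** The routes of a fixed number of customers have total probability one, so
    the routes of the customers who come after a given time can be summed out. *)
Lemma sum_prod_route_prob k (s : k.-tuple 'I_n) :
  \sum_(o : k.-tuple (option 'I_m)) \prod_l route_prob I x (tnth s l) (tnth o l) = 1.
Proof.
transitivity (\prod_(l < k) \sum_o route_prob I x (tnth s l) o).
  rewrite bigA_distr_bigA /= (reindex (@tuple_of_finfun _ k)) /=; last first.
    by apply: onW_bij; exists (@finfun_of_tuple _ k);
      [exact: tuple_of_finfunK|exact: finfun_of_tupleK].
  apply: eq_bigr => f _; apply: eq_bigr => l _.
  by rewrite -{2}(tuple_of_finfunK f) /finfun_of_tuple ffunE.
by apply: big1 => l _; exact: sum_route_prob.
Qed.

Lemma prod_route_cat k l (s : k.-tuple 'I_n) (s' : l.-tuple 'I_n)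
    (o : k.-tuple (option 'I_m)) (o' : l.-tuple (option 'I_m)) :
  \prod_a route_prob I x (tnth [tuple of s ++ s'] a) (tnth [tuple of o ++ o'] a) =
  (\prod_a route_prob I x (tnth s a) (tnth o a)) *
  (\prod_a route_prob I x (tnth s' a) (tnth o' a)).
Proof.
rewrite big_split_ord; congr (_ * _); apply: eq_bigr => a _.
  by rewrite !tnth_lshift.
by rewrite !tnth_rshift.
Qed.

End routing_law.

Section truncated_stream.
Context (R : realType) (m n : nat) (I : instance R m n).
Context (x : 'I_n -> 'I_m -> R).
Context d (Omega : measurableType d) (P : probability Omega R).
Context (X : Omega -> seq (customer R m n)).
Hypothesis orderedX : forall w, sorted (@earlier R m n) (X w).
Hypothesis measX : stream_measurable X.
Variable tau : R.

Let Y w := upto tau (X w).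

Definition prefix_box k l (B : set (k.-tuple R)) : set ((k + l).-tuple R) :=
  [set t | [/\ B (tleft t), (forall a, tnth (tleft t) a <= tau)
             & forall a, tau < tnth (tright t) a]].

Lemma measurable_prefix_box k l (B : set (k.-tuple R)) :
  measurable B -> measurable (@prefix_box k l B).
Proof.
move=> mB.
rewrite (_ : @prefix_box k l B = (@tleft R k l @^-1` B) `&`
  (@tleft R k l @^-1` [set t | forall a, [set y | y <= tau] (tnth t a)]) `&`
  (@tright R k l @^-1` [set t | forall a, [set y | tau < y] (tnth t a)])).
  apply: measurableI; first apply: measurableI.
  - by rewrite -[X in measurable X]setTI; exact: measurable_tleft.
  - rewrite -[X in measurable X]setTI; apply: measurable_tleft => //.
    apply: (measurable_all_tuple (A := fun=> [set y | y <= tau])) => a.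
    by rewrite -set_itvNyc.
  - rewrite -[X in measurable X]setTI; apply: measurable_tright => //.
    apply: (measurable_all_tuple (A := fun=> [set y | tau < y])) => a.
    by rewrite -set_itvoy.
by apply/seteqP; split=> [t [? ? ?]|t [[? ?] ?]]; do ?split.
Qed.

Let mark l : finType := (l.-tuple 'I_n * l.-tuple (option 'I_m))%type.

(** What has happened up to [tau] is the disjoint union, over the number, the
    types and the routes of the customers still to come, of events that concern
    the whole realization; only those have a prescribed probability. *)
Lemma stream_event_upto k (B : set (k.-tuple R))
    (s : k.-tuple 'I_n) (o : k.-tuple (option 'I_m)) :
  stream_event Y B s o = \bigcup_l \bigcup_(p : mark l)
    stream_event X (@prefix_box k l B) [tuple of s ++ p.1] [tuple of o ++ p.2].
Proof.
apply/seteqP; split=> w.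
- case=> t Bt Yw.
  have [t' [s' [ o2 Aw]]] := @customersP R m n _ (after tau (X w)) erefl.
  exists (size (after tau (X w))) => //; exists (s', o2) => //.
  exists [tuple of t ++ t'] => /=.
    rewrite /prefix_box /= tleftK trightK; split=> // a.
      have : all (fun y => y <= tau) t.
        by rewrite -(all_customers_time _ t s o) -Yw all_upto.
      by move/all_tnthP.
    have : all (fun y => tau < y) t'.
      by rewrite -(all_customers_time _ t' s' o2) -Aw /after filter_all.
    by move/all_tnthP.
  by rewrite customers_cat -Aw -Yw -upto_after.
- case=> l _ [[s' o2] _] [t [Bt h1 h2] Xw]; exists (tleft t) => //.
  rewrite /Y Xw -{1}(tsplitK t) customers_cat upto_cat //.
    by rewrite (all_customers_time (fun y => y <= tau)); apply/all_tnthP.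
  by rewrite (all_customers_time (fun y => tau < y)); apply/all_tnthP.
Qed.

Lemma arrival_event_fin (X' : Omega -> seq (customer R m n)) k (B : set (k.-tuple R)) s :
  arrival_event X' B s =
  \bigcup_(o : k.-tuple (option 'I_m)) stream_event X' B s o.
Proof. by apply/seteqP; split=> w [q]; [move=> h|move=> _ h]; exists q. Qed.

Lemma stream_event_measurable_cup k (B : set (k.-tuple R))
    (s : k.-tuple 'I_n) (o : k.-tuple (option 'I_m)) :
  measurable B -> forall l, measurable (\bigcup_(p : mark l)
    stream_event X (@prefix_box k l B) [tuple of s ++ p.1] [tuple of o ++ p.2]).
Proof.
move=> mB l; apply: fin_union_measurable => p.
by apply: measX; exact: measurable_prefix_box.
Qed.

Lemma stream_measurable_upto : stream_measurable Y.
Proof.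
move=> k B s o mB; rewrite stream_event_upto; apply: bigcupT_measurable => l.
exact: stream_event_measurable_cup.
Qed.

Lemma arrival_event_upto k (B : set (k.-tuple R)) (s : k.-tuple 'I_n) :
  arrival_event Y B s = \bigcup_l \bigcup_(s' : l.-tuple 'I_n)
    arrival_event X (@prefix_box k l B) [tuple of s ++ s'].
Proof.
apply/seteqP; split=> w.
- case=> q; rewrite stream_event_upto => -[l _ [[s' o2] _ h]].
  by exists l => //; exists s' => //; exists [tuple of q ++ o2].
- case=> l _ [s' _ [q h]]; exists (tleft q); rewrite stream_event_upto.
  by exists l => //; exists (s', tright q) => //=; rewrite tsplitK.
Qed.

Lemma stream_event_disjoint k l (B : set (k.-tuple R)) (B' : set (l.-tuple R)) s s' o o' w :
  stream_event X B s o w -> stream_event X B' s' o' w -> k = l.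
Proof. by case=> t _ Xw [t' _]; rewrite Xw => /customers_size_eq. Qed.

Lemma stream_event_inj k (B B' : set (k.-tuple R)) s s' o o' w :
  stream_event X B s o w -> stream_event X B' s' o' w -> s = s' /\ o = o'.
Proof. by case=> t _ Xw [t' _]; rewrite Xw => /customers_inj[]. Qed.

Lemma cat_tuple_inj (T : Type) k l (s1 s2 : k.-tuple T) (s1' s2' : l.-tuple T) :
  [tuple of s1 ++ s1'] = [tuple of s2 ++ s2'] -> s1' = s2'.
Proof. by move=> e; rewrite -(trightK s1 s1') e trightK. Qed.

(** Random routing is inherited by the stream stopped at [tau]: in the
    decomposition by the customers still to come, the factor contributed by
    their routes sums to one. *)
Lemma routing_upto d' (Z : measurableType d') (seed : Omega -> Z) :
  measurable_fun setT seed ->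
  routing_independent I x P X seed -> routing_independent I x P Y seed.
Proof.
move=> mseed rX k B s o C mB mC.
have mSC : measurable (seed @^-1` C) by rewrite -[X in measurable X]setTI; exact: mseed.
set SC := seed @^-1` C in mSC *.
pose pi_so := \prod_a route_prob I x (tnth s a) (tnth o a).
have PSC : P SC = (fine (P SC))%:E by rewrite fineK // fin_num_measure.
pose E l (p : mark l) := stream_event X (@prefix_box k l B)
  [tuple of s ++ p.1] [tuple of o ++ p.2].
pose A l (s' : l.-tuple 'I_n) := arrival_event X (@prefix_box k l B) [tuple of s ++ s'].
have mE l p : measurable (E l p) by apply: measX; exact: measurable_prefix_box.
have mA l s' : measurable (A l s').
  rewrite /A arrival_event_fin; apply: fin_union_measurable => o'.
  by apply: measX; exact: measurable_prefix_box.
have step l : P ((\bigcup_p E l p) `&` SC) =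
    ((pi_so * fine (P SC))%:E * P (\bigcup_s' A l s'))%E.
  rewrite setI_bigcupl measure_fin_union; first last.
  - move=> p q _ _ [w [[Ep _] [Eq _]]].
    have [/cat_tuple_inj e1 /cat_tuple_inj e2] := stream_event_inj Ep Eq.
    by case: p q e1 e2 {Ep Eq} => [? ?] [? ?] /= -> ->.
  - by move=> p; exact: measurableI.
  rewrite measure_fin_union; first last.
  - move=> s1 s2 _ _ [w [[q1 E1] [q2 E2]]].
    by have [/cat_tuple_inj] := stream_event_inj E1 E2.
  - exact: mA.
  rewrite ge0_sume_distrr //.
  transitivity (\sum_s' \sum_o' P (E l (s', o') `&` SC))%E.
    by rewrite pair_big /=; apply: eq_bigr => -[].
  apply: eq_bigr => s' _.
  transitivity (\sum_o' (pi_so * fine (P SC) * \prod_a route_prob I x (tnth s' a) (tnth o' a))%:E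
    * P (A l s'))%E.
    apply: eq_bigr => o' _.
    rewrite rX //; last exact: measurable_prefix_box.
    rewrite /= prod_route_cat -/pi_so PSC -/(A l s').
    rewrite -muleA -EFinM muleC; congr (_%:E * _)%E; rewrite -PSC; ring.
  have PA : P (A l s') = (fine (P (A l s')))%:E by rewrite fineK // fin_num_measure.
  rewrite PA; under eq_bigr do rewrite -EFinM.
  by rewrite sumEFin -big_distrl /= -big_distrr /= sum_prod_route_prob mulr1 EFinM -PA.
rewrite stream_event_upto setI_bigcupl measure_bigcup; first last.
- move=> l l' _ _ [w [[[p _ Ep] _] [[q _ Eq] _]]].
  by have /addnI := stream_event_disjoint Ep Eq.
- by move=> l _; apply: measurableI => //; exact: stream_event_measurable_cup.
rewrite arrival_event_upto measure_bigcup; first last.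
- move=> l l' _ _ [w [[s1 _ [q1 E1]] [s2 _ [q2 E2]]]].
  by have /addnI := stream_event_disjoint E1 E2.
- by move=> l _; apply: fin_union_measurable => s'; exact: mA.
rewrite (eq_eseriesr (g := fun l => ((pi_so * fine (P SC))%:E * P (\bigcup_s' A l s'))%E)); last by move=> l _; exact: step.
rewrite nneseriesZl // PSC -muleA -EFinM muleC -PSC.
by [].
Qed.

End truncated_stream.

(** * Poisson probabilities of lists of arrivals *)

HB.instance Definition _ (R : realType) (m n : nat) := gen_eqMixin (customer R m n).

Section cells.
Context (R : realType) (m n : nat).
Local Notation cust := (customer R m n).
Implicit Types (c : seq cust).

(** The cells follow each other in time, so that the customers of a realization
    with one customer per cell meet the cells in the order of their indices. *)
Definition separated k (J : 'I_k -> set R) : Prop :=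
  forall a b : 'I_k, (a < b)%N -> forall p q, J a p -> J b q -> p < q.

Lemma separated_eq k (J : 'I_k -> set R) a b p :
  separated J -> J a p -> J b p -> a = b.
Proof.
move=> sJ Ja Jb; apply/val_inj; case: (ltngtP a b) => // h.
  by have := sJ _ _ h _ _ Ja Jb; rewrite ltxx.
by have := sJ _ _ h _ _ Jb Ja; rewrite ltxx.
Qed.

Lemma count_customers_cell k (J : 'I_k -> set R) (t : k.-tuple R) (s : k.-tuple 'I_n)
    (q : k.-tuple (option 'I_m)) i b :
  separated J -> (forall a, J a (tnth t a)) ->
  count_arrivals (customers t s q) i (J b) = (tnth s b == i).
Proof.
move=> sJ Jt; rewrite /count_arrivals count_map.
rewrite (eq_count (a2 := fun a => (a == b) && (tnth s b == i))); last first.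
  move=> a /=; apply/idP/idP.
    by case/andP=> /eqP <- /set_mem /(separated_eq sJ (Jt a)) ->; rewrite !eqxx.
  by case/andP=> /eqP -> ->; rewrite mem_set.
case: (tnth s b == i); last by rewrite (eq_count (a2 := pred0)) ?count_pred0 // => a; rewrite andbF.
rewrite (eq_count (a2 := pred1 b)); last by move=> a; rewrite andbT.
by rewrite count_uniq_mem ?enum_uniq // mem_enum.
Qed.

Lemma count_arrivals_pos c i (B : set R) a :
  a \in c -> customer_type a = i -> B (arrival_time a) -> (0 < count_arrivals c i B)%N.
Proof.
move=> ac ai Ba; rewrite /count_arrivals -has_count; apply/hasP; exists a => //.
by rewrite ai eqxx mem_set.
Qed.

(** Counting customers recovers the ordered list when each cell holds exactly
    one: the earliest customer must be in the first cell, for otherwise the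
    customer of the first cell would come before it. The induction removes both. *)
Lemma one_customer_per_cell k (J : 'I_k -> set R) (s : 'I_k -> 'I_n) c :
  separated J -> sorted (@earlier R m n) c ->
  (forall a, a \in c -> exists b, J b (arrival_time a)) ->
  (forall i b, count_arrivals c i (J b) = (s b == i)) ->
  size c = k /\ forall b x0,
    J b (arrival_time (nth x0 c b)) /\ customer_type (nth x0 c b) = s b.
Proof.
elim: k J s c => [|k IH] J s c sJ sc cJ cnt.
  case: c sc cJ cnt => [|a c] _ cJ _; first by split=> // -[].
  by have [[]] := cJ a (mem_head _ _).
case: c sc cJ cnt => [|a c] sc cJ cnt.
  by have := cnt (s ord0) ord0; rewrite eqxx.
have sc' : sorted (@earlier R m n) c by exact: path_sorted sc.
have late b : b \in c -> arrival_time a < arrival_time b.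
  by move: sc; rewrite /= (path_sortedE (@earlier_trans R m n)) => /andP[/allP h _]; exact: h.
have Ja : J ord0 (arrival_time a).
  have [b Jb] := cJ a (mem_head _ _).
  case: (eqVneq b ord0) Jb => [-> //|b0] Jb.
  have lt0b : (@ord0 k < b)%N by rewrite lt0n.
  have : has (fun e => (customer_type e == s ord0) && (arrival_time e \in J ord0)) (a :: c).
    by rewrite has_count -/(count_arrivals _ _ _) cnt eqxx.
  case/hasP=> e; rewrite inE => /orP[/eqP ->|ec] /andP[_ /set_mem Je] //.
  by have := sJ _ _ lt0b _ _ Je Jb; have := late _ ec; lra.
have ta : s ord0 = customer_type a.
  have := count_arrivals_pos (mem_head a c) erefl Ja.
  by rewrite cnt; case: eqP.
have cnt0 i : count_arrivals c i (J ord0) = 0%N.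
  have := cnt i ord0; rewrite /count_arrivals /= -/(count_arrivals _ _ _) mem_set // andbT ta.
  by case: (_ == i); [case|].
have cJ' e : e \in c -> exists b, J (lift ord0 b) (arrival_time e).
  move=> ec; have [b] := cJ e (mem_behead (s := a :: c) ec).
  case: (unliftP ord0 b) => [b' ->|-> Je]; first by exists b'.
  by have := count_arrivals_pos ec erefl Je; rewrite cnt0.
have cnt' i b : count_arrivals c i (J (lift ord0 b)) = (s (lift ord0 b) == i).
  rewrite -cnt /count_arrivals /= memNset ?andbF //.
  by move=> Jb; have := separated_eq sJ Ja Jb.
have sJ' : separated (J \o lift ord0).
  by move=> b b' bb' p q; apply: sJ; rewrite /= /bump !add1n.
have [sz cells] := IH (J \o lift ord0) (s \o lift ord0) c sJ' sc' cJ' cnt'.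
split=> [|b x0]; first by rewrite /= sz.
by case: (unliftP ord0 b) => [b' ->|->] //=; exact: cells.
Qed.

End cells.

Section poisson_cells.
Context (R : realType) (m n : nat) (I : instance R m n).
Context d (Omega : measurableType d) (P : probability Omega R).
Context (X : Omega -> seq (customer R m n)).
Hypothesis orderedX : arrivals_ordered I X.
Hypothesis poissonX : poisson_arrivals I P X.

Local Notation mean := (mean_arrivals I).
Definition mass (B : set R) : R := \sum_i mean i B.

Definition span tau : set R := `[0, horizon I] `&` [set y | y <= tau].

Lemma measurable_span tau : measurable (span tau).
Proof. by apply: measurableI => //; rewrite -set_itvNyc. Qed.

Lemma mean_arrivals_ge0 i B : B `<=` `[0, horizon I] -> 0 <= mean i B.
Proof.
move=> BT; apply: Rintegral_ge0 => t /BT /=; rewrite in_itv /=; exact: rate_ge0.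
Qed.

Lemma integrable_rate i (B : set R) : measurable B -> B `<=` `[0, horizon I] ->
  (@lebesgue_measure R).-integrable B (EFin \o rate I i).
Proof. by move=> mB BT; apply: integrableS (rate_integrable I i). Qed.

Lemma mean_arrivals_setU i (A B : set R) : measurable A -> measurable B ->
  A `<=` `[0, horizon I] -> B `<=` `[0, horizon I] -> [disjoint A & B] ->
  mean i (A `|` B) = mean i A + mean i B.
Proof.
move=> mA mB AT BT dAB; rewrite /mean_arrivals Rintegral_setU //.
by apply: integrable_rate; [exact: measurableU|rewrite subUset].
Qed.

Lemma mean_arrivals_cells i k (J : 'I_k -> set R) (C : set R) :
  measurable C -> C `<=` `[0, horizon I] -> (forall a, measurable (J a)) ->
  (forall a, J a `<=` C) -> separated J ->
  mean i C = mean i (C `\` \bigcup_a J a) + \sum_a mean i (J a).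
Proof.
elim: k J C => [|k IH] J C mC CT mJ JC sJ.
  by rewrite big_ord0 addr0; congr (mean i _); rewrite bigcup0 ?setD0 // => -[].
have sJ' : separated (J \o lift ord0).
  by move=> b b' bb' p q; apply: sJ; rewrite /= /bump !add1n.
rewrite big_ord_recl /=.
have mD : measurable (C `\` J ord0) by exact: measurableD.
have DT : C `\` J ord0 `<=` `[0, horizon I] by move=> y [/CT].
have := IH (J \o lift ord0) _ mD DT (fun a => mJ _) _ sJ'.
have -> : (C `\` J ord0) `\` \bigcup_a (J \o lift ord0) a = C `\` \bigcup_a J a.
  rewrite setDDl; congr (_ `\` _); apply/seteqP; split=> y.
    by case=> [J0|[a _ Ja]]; [exists ord0|exists (lift ord0 a)].
  case=> a _; case: (unliftP ord0 a) => [b ->|->] Ja; [right|left] => //.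
  by exists b.
move=> h; rewrite addrCA -h; last first.
  move=> a y Ja; split; first exact: JC Ja.
  by move=> J0; have := separated_eq sJ J0 Ja.
rewrite -mean_arrivals_setU //.
- by rewrite setDUK //; exact: JC.
- by move=> y /JC /CT.
- by apply/disj_setPS => y [? []].
Qed.

Lemma mass_cells k (J : 'I_k -> set R) (C : set R) :
  measurable C -> C `<=` `[0, horizon I] -> (forall a, measurable (J a)) ->
  (forall a, J a `<=` C) -> separated J ->
  mass C = mass (C `\` \bigcup_a J a) + \sum_a mass (J a).
Proof.
move=> mC CT mJ JC sJ; rewrite /mass exchange_big -big_split /=.
by apply: eq_bigr => i _; exact: mean_arrivals_cells.
Qed.

Lemma arrival_timeP w a : a \in X w -> 0 <= arrival_time a <= horizon I.
Proof. by have [_ /allP h] := orderedX w; exact: h. Qed.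

Lemma count_arrivals_upto tau c i (B : set R) : (forall y, B y -> y <= tau) ->
  count_arrivals c i B = count_arrivals (upto tau c : seq (customer R m n)) i B.
Proof.
move=> Btau; rewrite /count_arrivals /upto count_filter; apply: eq_count => a /=.
case: (boolP (arrival_time a \in B)) => [/set_mem /Btau h|_]; last by rewrite andbF.
by rewrite h !andbT.
Qed.

Lemma poisson_mass0 mu : poisson_mass mu 0 = expR (- mu) :> R.
Proof. by rewrite /poisson_mass expr0 mulr1 fact0 divr1. Qed.

Lemma poisson_mass1 mu : poisson_mass mu 1 = mu * expR (- mu) :> R.
Proof. by rewrite /poisson_mass expr1 factS fact0 divr1 mulrC. Qed.

Lemma prod_poisson_single (i0 : 'I_n) (B : set R) :
  \prod_i poisson_mass (mean i B) (i0 == i) = mean i0 B * expR (- mass B).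
Proof.
rewrite (bigD1 i0) //= eqxx poisson_mass1 -mulrA; congr (_ * _).
rewrite [mass B](bigD1 i0) //= opprD expRD; congr (_ * _).
rewrite -sumrN expR_sum; apply: eq_bigr => i ii0.
by rewrite eq_sym (negbTE ii0) poisson_mass0.
Qed.

(** The arrivals up to [tau] fall one by one into given consecutive cells, with
    given types, exactly when each cell has one customer, of the right type, and
    the rest of [span tau] has none. In the product of Poisson probabilities the
    exponentials recombine to [expR (- mass (span tau))] whatever the cells are;
    this product form is the source of all independence below. *)
Lemma prob_cells tau k (J : 'I_k -> set R) (s : k.-tuple 'I_n) :
  (forall a, measurable (J a)) -> (forall a, J a `<=` span tau) -> separated J ->
  P (arrival_event (fun w => upto tau (X w)) [set t | forall a, J a (tnth t a)] s) =
  ((\prod_a mean (tnth s a) (J a)) * expR (- mass (span tau)))%:E.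
Proof.
move=> mJ Jspan sJ.
have spanT : span tau `<=` `[0, horizon I] by move=> y [].
pose rest := span tau `\` \bigcup_a J a.
have mrest : measurable rest.
  apply: measurableD; first exact: measurable_span.
  by apply: fin_union_measurable => a; exact: mJ.
(* index 0 stands for the part of [span tau] outside the cells *)
pose B (l : 'I_k.+1) := if unlift ord0 l is Some a then J a else rest.
pose N (i : 'I_n) (l : 'I_k.+1) : nat :=
  if unlift ord0 l is Some a then (tnth s a == i) : nat else 0%N.
have Bspan l : B l `<=` span tau.
  by rewrite /B; case: unliftP => [a|] _; [exact: Jspan|move=> y []].
have := @poissonX k.+1 B N.
rewrite (_ : [set w | _] = arrival_event (fun w => upto tau (X w))
    [set t | forall a, J a (tnth t a)] s); last first.
  apply/seteqP; split=> w /=.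
  - move=> cnt.
    have cntJ i a : count_arrivals (upto tau (X w)) i (J a) = (tnth s a == i).
      have := cnt i (lift ord0 a); rewrite /B /N liftK => <-.
      by rewrite [RHS](@count_arrivals_upto tau) // => y /Jspan[].
    have cJ a : a \in upto tau (X w) -> exists b, J b (arrival_time a).
      move=> ay; apply: contrapT => nJ.
      have := cnt (customer_type a) ord0; rewrite /B /N unlift_none.
      rewrite (@count_arrivals_upto tau); last by move=> y [[]].
      move/eqP; rewrite -leqn0 leqNgt => /negP; apply.
      apply: (count_arrivals_pos ay) => //; split.
        move: ay; rewrite mem_filter => /andP[at0 /arrival_timeP aT].
        by split=> //=; rewrite in_itv.
      by move=> [b _ Jb]; apply: nJ; exists b.
    have so : sorted (@earlier R m n) (upto tau (X w)).
      by apply: sorted_upto; have [] := orderedX w.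
    have [sz cells] := one_customer_per_cell sJ so cJ cntJ.
    have [t [s' [q Yw]]] := customersP sz.
    have nthc x0 (b : 'I_k) : nth x0 (customers t s' q) b =
        Customer (tnth t b) (tnth s' b) (tnth q b).
      by rewrite (nth_map b) ?size_enum_ord // nth_ord_enum.
    exists q; exists t.
      by move=> b; have [] := cells b (Customer (tnth t b) (tnth s' b) (tnth q b)); rewrite Yw nthc.
    rewrite Yw; congr customers; apply: eq_from_tnth => b.
    by have [] := cells b (Customer (tnth t b) (tnth s' b) (tnth q b)); rewrite Yw nthc.
  - case=> q [t Jt Yw] i l.
    rewrite (@count_arrivals_upto tau); last by move=> y /Bspan[].
    rewrite Yw /B /N; case: unliftP => [a|] _; first exact: count_customers_cell.
    apply/eqP; rewrite -leqn0 leqNgt -has_count; apply/hasP => -[a].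
    rewrite /customers => /mapP[b _ ->] /= /andP[_ /set_mem[_]]; apply.
    by exists b.
move=> ->; first congr (_%:E).
- rewrite exchange_big big_ord_recl /=.
  rewrite (eq_bigr (fun i => expR (- mean i rest))); last first.
    by move=> i _; rewrite /N /B unlift_none poisson_mass0.
  rewrite -expR_sum sumrN -/(mass rest).
  rewrite (eq_bigr (fun a => mean (tnth s a) (J a) * expR (- mass (J a)))); last first.
    move=> a _; rewrite -prod_poisson_single; apply: eq_bigr => i _.
    by rewrite /N /B liftK.
  rewrite big_split /= -expR_sum sumrN mulrCA -expRD -opprD.
  by rewrite -mass_cells //; exact: measurable_span.
- by move=> l; rewrite /B; case: unliftP.
- by move=> l y /Bspan /spanT.
- move=> l l' _ _ [y []]; rewrite /B.
  case: unliftP => [a ->|->]; case: unliftP => [b ->|->] //.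
  + by move=> Ja Jb; rewrite (separated_eq sJ Ja Jb).
  + by move=> Ja [_]; case; exists a.
  + by move=> [_ nJ] Jb; case: nJ; exists b.
Qed.

End poisson_cells.

(** * Measurability of events about the stream *)

Section data_measurability.
Context (R : realType) (m n : nat).
Context d (Omega : measurableType d) (Y : Omega -> seq (customer R m n)).
Context d' (Z : measurableType d') (seed : Omega -> Z).
Hypothesis mseed : measurable_fun setT seed.
Hypothesis mY : forall k s (q : k.-tuple (option 'I_m)), measurable (stream_event Y setT s q).
Hypothesis mYcoord : forall k (a : 'I_k) (Q : set R) s q, measurable Q ->
  measurable (stream_event Y [set t : k.-tuple R | Q (tnth t a)] s q).

Let coord k (c : seq (customer R m n)) : k.-tuple R :=
  [tuple nth 0 (map (@arrival_time R m n) c) a | a < k].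

Let coord_customers k (t : k.-tuple R) (s : k.-tuple 'I_n) (q : k.-tuple (option 'I_m)) :
  coord k (customers t s q) = t.
Proof.
by apply: eq_from_tnth => a; rewrite tnth_mktuple map_arrival_time -tnth_nth.
Qed.

Let measurable_coord k : measurable_fun setT (coord k \o Y).
Proof.
apply/measurable_fun_tnthP => a _ Q mQ; rewrite setTI.
rewrite (_ : _ @^-1` _ = \bigcup_l
    \bigcup_(p : (l.-tuple 'I_n * l.-tuple (option 'I_m))%type)
      stream_event Y [set t : l.-tuple R | Q (nth 0 t a)] p.1 p.2); last first.
  apply/seteqP; split=> w /=.
    rewrite tnth_mktuple => Qw.
    have [t [s [q Yw]]] := @customersP R m n _ (Y w) erefl.
    exists (size (Y w)) => //; exists (s, q) => //=; exists t => //=.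
    by move: Qw; rewrite {1}Yw map_arrival_time.
  by case=> l _ [[s q] _ [t Qt Yw]]; rewrite tnth_mktuple Yw map_arrival_time.
apply: bigcupT_measurable => l; apply: fin_union_measurable => -[s q] /=.
have [al|la] := ltnP a l.
  rewrite (_ : [set t : l.-tuple R | _] = [set t | Q (tnth t (Ordinal al))]); first exact: mYcoord.
  by apply/seteqP; split=> t /=; rewrite (tnth_nth 0).
(* there is no customer number [a], and the coordinate has its default value 0 *)
have [Q0|nQ0] := pselect (Q 0).
  rewrite (_ : [set t : l.-tuple R | _] = setT); first exact: mY.
  by apply/seteqP; split=> t //= _; rewrite nth_default ?size_tuple.
rewrite (_ : stream_event _ _ _ _ = set0) //.
by apply/seteqP; split=> // w [t /=]; rewrite nth_default ?size_tuple.
Qed.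

(** An event is measurable if, for every number of customers and all types and
    routes, it is measurable in the seed and the times. The assumptions on [Y]
    ask only for coordinatewise events, so that the lemma can also be applied
    with the smaller sigma-algebra of past events in place of the given one. *)
Lemma data_measurable (S : Z -> seq (customer R m n) -> Prop) :
  (forall k s (q : k.-tuple (option 'I_m)),
     measurable [set y : Z * k.-tuple R | S y.1 (customers y.2 s q)]) ->
  measurable [set w | S (seed w) (Y w)].
Proof.
move=> mS.
rewrite (_ : mkset _ = \bigcup_k \bigcup_(p : (k.-tuple 'I_n * k.-tuple (option 'I_m))%type)
   (stream_event Y setT p.1 p.2 `&` (fun w => (seed w, (coord k \o Y) w)) @^-1`
     [set y : Z * k.-tuple R | S y.1 (customers y.2 p.1 p.2)])); last first.
  apply/seteqP; split=> w /=.
    have [k] : exists k, size (Y w) = k by exists (size (Y w)).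
    move=> /customersP[t [s [q Yw]]] Sw.
    exists k => //; exists (s, q) => //=; split; first by exists t.
    have -> : coord k (Y w) = t by rewrite Yw coord_customers.
    by rewrite -Yw.
  by case=> k _ [[s q] _ [[t _ Yw]]] /=; rewrite Yw coord_customers.
apply: bigcupT_measurable => k; apply: fin_union_measurable => -[s q] /=.
apply: measurableI => //; rewrite -[X in measurable X]setTI.
by apply: (measurable_fun_pair mseed (@measurable_coord k)) => //; exact: mS.
Qed.

End data_measurability.

Section rational_cells.
Context (R : realType).

(** The cells cut out by rational thresholds [y]: cell [a] lies beyond the
    thresholds up to [a] and not beyond the later ones. Written in this way the
    cells are separated even if [y] is not increasing (some are then empty). *)
Definition rat_cell k (y : k.-tuple rat) (a : 'I_k) : set R :=
  [set p | forall b : 'I_k, if (b <= a)%N then ratr (tnth y b) < p else p <= ratr (tnth y b)].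

Lemma measurable_rat_cell k (y : k.-tuple rat) a : measurable (rat_cell y a).
Proof.
rewrite (_ : rat_cell y a = \bigcap_(b in [set: 'I_k])
   [set p | if (b <= a)%N then ratr (tnth y b) < p else p <= ratr (tnth y b)]).
  apply: fin_bigcap_measurable; first exact: finite_finset.
  move=> b _; case: (b <= a)%N; first by rewrite -(set_itvoy (ratr (tnth y b) : R)).
  by rewrite -(set_itvNyc (ratr (tnth y b) : R)).
by apply/seteqP; split=> p /= h b; [move=> _; exact: h|exact: (h b I)].
Qed.

Lemma separated_rat_cell k (y : k.-tuple rat) : separated (rat_cell y).
Proof.
move=> a b ab p p' /(_ b) + /(_ b); rewrite leqnn leqNgt ab /=; exact: le_lt_trans.
Qed.

(** Strictly increasing times are separated by rational thresholds; hence
    countably many families of cells exhaust all realizations. *)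
Lemma rat_cell_cover k (t : k.-tuple R) :
  (forall a b : 'I_k, (a < b)%N -> tnth t a < tnth t b) ->
  exists y, forall a, rat_cell y a (tnth t a).
Proof.
move=> incr.
have ex (b : 'I_k) : exists q : rat, (forall a : 'I_k, (a < b)%N -> tnth t a < ratr q) /\ ratr q < tnth t b.
  have [b0|b0] := posnP b.
    have [q] := @rat_in_itvoo R (tnth t b - 1) (tnth t b) ltac:(lra).
    rewrite in_itv /= => /andP[_ qt]; exists q; split=> // a; by rewrite b0.
  have pb : (b.-1 < k)%N by rewrite (leq_ltn_trans (leq_pred b)).
  have lt : tnth t (Ordinal pb) < tnth t b by apply: incr; rewrite /= prednK.
  have [q] := rat_in_itvoo lt; rewrite in_itv /= => /andP[tq qt].
  exists q; split=> // a ab; apply: le_lt_trans tq.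
  have [->//|] := eqVneq a (Ordinal pb).
  rewrite -val_eqE /= => ne; apply: ltW; apply: incr => /=.
  by rewrite ltn_neqAle ne /= -ltnS prednK.
have [f fP] := choice ex.
exists [tuple f b | b < k] => a b; rewrite tnth_mktuple.
have [lo hi] := fP b; case: ifPn => [ba|]; last first.
  by rewrite -ltnNge => ab; apply: ltW; exact: lo.
apply: lt_le_trans hi _; have [->//|ne] := eqVneq b a.
by apply: ltW; apply: incr; rewrite ltn_neqAle ba andbT.
Qed.

End rational_cells.

(** * Independence of the past and the next window *)

Section independent_increments.
Context (R : realType) (m n : nat) (I : instance R m n).
Context (x : 'I_n -> 'I_m -> R).
Context d (Omega : measurableType d) (P : probability Omega R).
Context (X : Omega -> seq (customer R m n)).
Context d' (Z : measurableType d') (seed : Omega -> Z).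
Hypothesis orderedX : arrivals_ordered I X.
Hypothesis measX : stream_measurable X.
Hypothesis poissonX : poisson_arrivals I P X.
Hypothesis mseed : measurable_fun setT seed.
Hypothesis routX : routing_independent I x P X seed.
Variables tau tau' : R.
Hypothesis tautau' : tau <= tau'.

Let Y w := upto tau (X w).
Let Y' w := upto tau' (X w).

Local Notation mean := (mean_arrivals I).

Definition window : set R := span I tau' `&` [set y | tau < y].

Definition single_arrival (i : 'I_n) (j : 'I_m) : set Omega :=
  [set w | exists a, [/\ Y' w = Y w ++ [:: a], tau < arrival_time a,
                         customer_type a = i & routed_to a = Some j]].

Let sortedX w : sorted (@earlier R m n) (X w).
Proof. by have [] := orderedX w. Qed.

Lemma measurable_window : measurable window.
Proof. by apply: measurableI; [exact: measurable_span|rewrite -set_itvoy]. Qed.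

Let windowT : window `<=` `[0, horizon I].
Proof. by move=> y [[]]. Qed.

Lemma mean_window i : mean i (span I tau') = mean i (span I tau) + mean i window.
Proof.
rewrite -mean_arrivals_setU //; first congr (mean i _).
- apply/seteqP; split=> y.
    by case=> yT yt; case: (leP y tau) => h; [left|right].
  by case=> [[yT yt]|[]] //; split=> //=; exact: le_trans tautau'.
- exact: measurable_span.
- exact: measurable_window.
- by move=> y [].
- by apply/disj_setPS => y [[_ /= h1] [_ /= h2]]; lra.
Qed.

Lemma mass_window : mass I (span I tau') = mass I (span I tau) + mass I window.
Proof. by rewrite /mass -big_split /=; apply: eq_bigr => i _; exact: mean_window. Qed.

Definition extend_cells k (J : 'I_k -> set R) (a : 'I_(k + 1)) : set R :=
  if fintype.split a is inl b then J b else window.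

Lemma extend_cells_l k (J : 'I_k -> set R) b : extend_cells J (lshift 1 b) = J b.
Proof. by rewrite /extend_cells (unsplitK (inl b)). Qed.

Lemma extend_cells_r k (J : 'I_k -> set R) b : extend_cells J (rshift k b) = window.
Proof. by rewrite /extend_cells (unsplitK (inr b)). Qed.

Lemma separated_extend k (J : 'I_k -> set R) : (forall a, J a `<=` span I tau) ->
  separated J -> separated (extend_cells J).
Proof.
move=> Jspan sJ a b; rewrite -(splitK a) -(splitK b).
case: (fintype.split a) => a' /=; case: (fintype.split b) => b' /=.
- by rewrite !extend_cells_l; exact: sJ.
- rewrite extend_cells_l extend_cells_r => _ p q /Jspan[_ /= h1] [_ /= h2]; lra.
- by move=> h; have := ltn_ord b'; rewrite ltnNge; move: h; rewrite ltnNge => /negP; case;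
    rewrite ltnW // (leq_trans (ltn_ord b')) // leq_addr.
- by rewrite ord1 (ord1 b') ltnn.
Qed.

(** Knowing that the window contains one customer turns an event about the past
    with [k] cells into an event of the same kind with [k + 1] cells. *)
Lemma single_arrival_cells k (J : 'I_k -> set R) (s : k.-tuple 'I_n)
    (q : k.-tuple (option 'I_m)) i j : (forall a, J a `<=` span I tau) ->
  stream_event Y [set t | forall a, J a (tnth t a)] s q `&` single_arrival i j =
  stream_event Y' [set t | forall a, extend_cells J a (tnth t a)]
    [tuple of s ++ [tuple i]] [tuple of q ++ [tuple Some j]].
Proof.
move=> Jspan; apply/seteqP; split=> w.
- case=> [[t Jt Yw] [[t0 i0 q0] [Yw' /= t0tau ei eq]]]; subst i0 q0.
  exists [tuple of t ++ [tuple t0]]; last first.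
    rewrite Yw' Yw customers_cat; congr (_ ++ _).
    by apply: customer_list_eq; rewrite ?map_arrival_time ?map_customer_type ?map_routed_to.
  move=> a; rewrite -(splitK a); case: (fintype.split a) => b /=.
    by rewrite extend_cells_l tnth_lshift.
  rewrite extend_cells_r tnth_rshift (tnth_nth 0) ord1 /=.
  have : Customer t0 i (Some j) \in Y' w by rewrite Yw' mem_cat inE eqxx orbT.
  rewrite mem_filter /= => /andP[t0tau' t0X]; split=> //; split=> //=.
  by rewrite in_itv /=; exact: (arrival_timeP orderedX t0X).
- case=> t Jt; rewrite -{1}(tsplitK t) customers_cat => Yw'.
  have Jl a : J a (tnth (tleft t) a).
    by rewrite tnth_mktuple -extend_cells_l; exact: Jt.
  have Jr : tau < tnth (tright t) ord0.
    by have := Jt (rshift k ord0); rewrite extend_cells_r tnth_mktuple => -[].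
  have Yw : Y w = customers (tleft t) s q.
    rewrite /Y -(upto_upto (X w) tautau') -/(Y' w) Yw' upto_cat //.
      rewrite (all_customers_time (fun y => y <= tau)); apply/all_tnthP => a.
      by have [_] := Jspan _ _ (Jl a).
    rewrite (all_customers_time (fun y => tau < y)); apply/all_tnthP => a.
    by rewrite ord1.
  split; first by exists (tleft t).
  exists (Customer (tnth (tright t) ord0) i (Some j)); split=> //=.
  rewrite Yw' Yw; congr (_ ++ _).
  apply: customer_list_eq; rewrite ?map_arrival_time ?map_customer_type ?map_routed_to //=.
  by rewrite -[LHS](map_tnth_enum (tright t)) enum_ordSl enum_ord0.
Qed.

Lemma measurable_single_arrival i j : measurable (single_arrival i j).
Proof.
rewrite (_ : single_arrival i j =
  \bigcup_k \bigcup_(p : (k.-tuple 'I_n * k.-tuple (option 'I_m))%type)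
  (stream_event Y [set t | forall a : 'I_k, span I tau (tnth t a)] p.1 p.2 `&` single_arrival i j)).
  apply: bigcupT_measurable => k; apply: fin_union_measurable => -[s q] /=.
  rewrite (@single_arrival_cells k (fun=> span I tau)); last by move=> a y.
  apply: (stream_measurable_upto sortedX measX).
  apply: measurable_all_tuple => a; rewrite /extend_cells.
  by case: (fintype.split a) => _; [exact: measurable_span|exact: measurable_window].
apply/seteqP; split=> w; last by case=> k _ [p _ []].
move=> Sw; have [k] : exists k, size (Y w) = k by exists (size (Y w)).
move=> /customersP[t [s [q Yw]]]; exists k => //; exists (s, q) => //; split=> //.
exists t => // a.
have : all (fun b => (0 <= arrival_time b <= horizon I) && (arrival_time b <= tau)) (Y w).
  apply/allP => b; rewrite mem_filter => /andP[-> bX].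
  by rewrite (arrival_timeP orderedX bX).
rewrite Yw (all_customers_time (fun y => (0 <= y <= horizon I) && (y <= tau))).
by move/all_tnthP/(_ a)/andP => -[h1 h2]; split=> //=; rewrite in_itv.
Qed.

Definition single_prob i j : R :=
  mean i window * expR (- mass I window) * route_prob I x i (Some j).

(** Independence on the generating events: by [routing_upto] and [prob_cells]
    the probability is a product over the customers, and the customer of the
    window contributes the factor [single_prob]. *)
Lemma prob_single_cells k (J : 'I_k -> set R) (s : k.-tuple 'I_n)
    (q : k.-tuple (option 'I_m)) (C : set Z) i j :
  (forall a, measurable (J a)) -> (forall a, J a `<=` span I tau) -> separated J ->
  measurable C ->
  P (stream_event Y [set t | forall a, J a (tnth t a)] s q `&` seed @^-1` C
     `&` single_arrival i j) =
  ((single_prob i j)%:E *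
   P (stream_event Y [set t | forall a, J a (tnth t a)] s q `&` seed @^-1` C))%E.
Proof.
move=> mJ Jspan sJ mC.
rewrite setIAC single_arrival_cells //.
have mEJ a : measurable (extend_cells J a).
  by rewrite /extend_cells; case: (fintype.split a) => [b|_]; [exact: mJ|exact: measurable_window].
rewrite (routing_upto sortedX measX _ mseed routX) //; last exact: measurable_all_tuple.
rewrite (routing_upto sortedX measX _ mseed routX) //; last exact: measurable_all_tuple.
rewrite (prob_cells orderedX poissonX) //; last exact: separated_extend.
- rewrite (prob_cells orderedX poissonX) //.
  rewrite prod_route_cat mass_window big_split_ord /=.
  have -> : \prod_(a < k) mean (tnth [tuple of s ++ [tuple i]] (lshift 1 a))
      (extend_cells J (lshift 1 a)) = \prod_(a < k) mean (tnth s a) (J a).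
    by apply: eq_bigr => a _; rewrite tnth_lshift extend_cells_l.
  rewrite !big_ord1 tnth_rshift extend_cells_r !(tnth_nth i) !(tnth_nth None) /=.
  rewrite opprD expRD /single_prob muleA muleA -!EFinM.
  by congr (_%:E * _)%E; rewrite /=; ring.
- move=> a y; rewrite -(splitK a); case: (fintype.split a) => b /=.
    by rewrite extend_cells_l => /Jspan[h1 h2]; split=> //=; exact: le_trans tautau'.
  by rewrite extend_cells_r => -[].
Qed.

Let box k (J : 'I_k -> set R) (s : k.-tuple 'I_n) (q : k.-tuple (option 'I_m)) (C : set Z) :=
  stream_event Y [set t | forall a, J a (tnth t a)] s q `&` seed @^-1` C.

(** A family of events closed under intersection that generates everything
    known at time [tau]; on these events probabilities are explicit. *)
Definition past_boxes : set (set Omega) :=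
  [set A | exists k (J : 'I_k -> set R) s q C,
    [/\ forall a, measurable (J a), forall a, J a `<=` span I tau, separated J,
        measurable C & A = box J s q C]].

Let measurable_seed C : measurable C -> measurable (seed @^-1` C).
Proof. by move=> mC; rewrite -[X in measurable X]setTI; exact: mseed. Qed.

Let past_boxes_measurable : past_boxes `<=` measurable.
Proof.
move=> _ [k [J [s [q [C [mJ _ _ mC ->]]]]]]; apply: measurableI; last exact: measurable_seed.
by apply: (stream_measurable_upto sortedX measX); exact: measurable_all_tuple.
Qed.

Let separated_subset k (J J' : 'I_k -> set R) :
  (forall a, J' a `<=` J a) -> separated J -> separated J'.
Proof. by move=> JJ sJ a b ab p p' /JJ Jp /JJ; exact: sJ Jp. Qed.

Let past_boxes_setI : setI_closed past_boxes.
Proof.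
move=> _ _ [k [J [s [q [C [mJ hJ sJ mC ->]]]]]] [k' [J' [s' [q' [C' [mJ' hJ' sJ' mC' ->]]]]]].
have [[w [[[t Jt Yw] Cw] [[t' Jt' Yw'] Cw']]]|ne] :=
    pselect (box J s q C `&` box J' s' q' C' !=set0).
  have kk : k' = k by move: Yw'; rewrite Yw => /esym /customers_size_eq.
  subst k'; move: Yw'; rewrite Yw => /customers_inj[_ ss qq]; subst s' q'.
  exists k, (fun a => J a `&` J' a), s, q, (C `&` C'); split.
  - by move=> a; exact: measurableI.
  - by move=> a y [/hJ].
  - by apply: (separated_subset _ sJ) => a y [].
  - exact: measurableI.
  - apply/seteqP; split=> v.
      case=> [[[t1 Jt1 Yv] Cv] [[t2 Jt2 Yv'] Cv']]; split=> //; exists t1 => // a.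
      by split; [exact: Jt1|move: Yv'; rewrite Yv => /customers_inj[-> _ _]; exact: Jt2].
    case=> [[t1 Jt1 Yv] [Cv Cv']].
    by split; split=> //; exists t1 => // a; have [] := Jt1 a.
exists k, J, s, q, set0; split=> //.
rewrite /box preimage_set0 setI0; apply/seteqP; split=> // v bv.
by apply: ne; exists v.
Qed.

Let index : countType :=
  {k : nat & (k.-tuple 'I_n * k.-tuple (option 'I_m) * k.-tuple rat)%type}.

Let cover_box (e : index) : set Omega :=
  let: existT k (s, q, y) := e in
  box (fun a => span I tau `&` rat_cell y a) s q setT.

Let cover_box_past e : past_boxes (cover_box e).
Proof.
case: e => k [[s q] y].
exists k, (fun a => span I tau `&` rat_cell y a), s, q, setT; split=> //.
- by move=> a; apply: measurableI; [exact: measurable_span|exact: measurable_rat_cell].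
- by apply: (separated_subset _ (@separated_rat_cell R k y)) => a; exact: subIsetr.
Qed.

Let times_cover k (t : k.-tuple R) s q w : Y w = customers t s q ->
  exists y, forall a, (span I tau `&` rat_cell y a) (tnth t a).
Proof.
move=> Yw.
have : sorted (fun p p' => p < p') t.
  rewrite -(map_arrival_time t s q) -Yw sorted_map.
  by have := sorted_upto tau (sortedX w).
move=> st.
have [|y yP] := @rat_cell_cover R k t.
  move=> a b ab; rewrite !(tnth_nth 0).
  by apply: (sorted_ltn_nth lt_trans) => //; rewrite inE size_tuple.
exists y => a; split; last exact: yP.
have : all (fun b => (0 <= arrival_time b <= horizon I) && (arrival_time b <= tau)) (Y w).
  apply/allP => b; rewrite mem_filter => /andP[-> bX].
  by rewrite (arrival_timeP orderedX bX).
rewrite Yw (all_customers_time (fun y => (0 <= y <= horizon I) && (y <= tau))).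
by move/all_tnthP/(_ a)/andP => -[h1 h2]; split=> //=; rewrite in_itv.
Qed.

Let cover_boxP w : exists e, cover_box e w.
Proof.
have [k] : exists k, size (Y w) = k by exists (size (Y w)).
move=> /customersP[t [s [q Yw]]].
have [y yP] := times_cover Yw.
by exists (existT _ k (s, q, y)); split=> //; exists t.
Qed.

Let past_algebra := <<s past_boxes>>.

(* The next lemmas show that the stream and the seed are measurable for
   [past_algebra]: each event is a countable union of boxes over rational
   thresholds. *)

Let past_union (U : countType) (F : U -> set Omega) :
  (forall u, past_algebra (F u)) -> past_algebra (\bigcup_u F u).
Proof.
move=> hF; apply: (@countable_bigcupT_measurable _ (g_sigma_algebraType past_boxes)) => //.
Qed.

Let past_stream k (a : 'I_k) (Q : set R) (s : k.-tuple 'I_n) (q : k.-tuple (option 'I_m)) :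
  measurable Q -> past_algebra (stream_event Y [set t | Q (tnth t a)] s q).
Proof.
move=> mQ.
rewrite (_ : stream_event _ _ _ _ = \bigcup_(y : k.-tuple rat)
  box (fun b => span I tau `&` rat_cell y b `&` [set p | b == a -> Q p]) s q setT).
  apply: past_union => y; apply: sub_sigma_algebra.
  exists k, (fun b => span I tau `&` rat_cell y b `&` [set p | b == a -> Q p]), s, q, setT.
  split=> //.
  - move=> b; apply: measurableI.
      by apply: measurableI; [exact: measurable_span|exact: measurable_rat_cell].
    case: (eqVneq b a) => _.
      by rewrite (_ : mkset _ = Q) //; apply/seteqP; split=> p /=; [exact|by move=> ? _].
    by rewrite (_ : mkset _ = setT) //; apply/seteqP; split.
  - by move=> b p [[]].
  - by apply: (separated_subset _ (@separated_rat_cell R k y)) => b p [[]].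
apply/seteqP; split=> w.
  case=> t Qt Yw; have [y yP] := times_cover Yw; exists y => //; split=> //.
  by exists t => // b; split; [exact: yP|move=> /= /eqP ->].
by case=> y _ [[t ht Yw] _]; exists t => //; have [_] := ht a; rewrite /= eqxx; exact.
Qed.

Let past_types k (s : k.-tuple 'I_n) (q : k.-tuple (option 'I_m)) :
  past_algebra (stream_event Y setT s q).
Proof.
rewrite (_ : stream_event _ _ _ _ = \bigcup_(y : k.-tuple rat) cover_box (existT _ k (s, q, y))).
  by apply: past_union => y; apply: sub_sigma_algebra; exact: cover_box_past.
apply/seteqP; split=> w.
  case=> t Qt Yw; have [y yP] := times_cover Yw; exists y => //; split=> //.
  by exists t.
by case=> y _ [[t ht Yw] _]; exists t.
Qed.

Let past_seed (C : set Z) : measurable C -> past_algebra (seed @^-1` C).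
Proof.
move=> mC.
rewrite (_ : _ @^-1` _ = \bigcup_(e : index) (cover_box e `&` seed @^-1` C)).
  apply: past_union => e; apply: sub_sigma_algebra.
  have [k [J [s [q [C' [mJ hJ sJ mC' ->]]]]]] := cover_box_past e.
  exists k, J, s, q, (C' `&` C); split=> //; first exact: measurableI.
  by rewrite /box -setIA.
apply/seteqP; split=> w; last by case=> e _ [].
by move=> Cw; have [e we] := cover_boxP w; exists e.
Qed.

Hypothesis x_ge0 : forall i j, 0 <= x i j.

Lemma single_prob_ge0 i j : 0 <= single_prob i j.
Proof.
apply: mulr_ge0; last by apply: divr_ge0 => //; exact: mean_arrivals_ge0.
by rewrite mulr_ge0 ?expR_ge0 // mean_arrivals_ge0.
Qed.

(** The two sides are finite measures in [E] that agree on [past_boxes]. *)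
Lemma past_algebra_independent (E : set Omega) i j : past_algebra E ->
  P (E `&` single_arrival i j) = ((single_prob i j)%:E * P E)%E.
Proof.
have mS := measurable_single_arrival i j.
pose g (l : nat) := if unpickle l is Some e then cover_box e else box (k := 0) (fun=> set0) [tuple] [tuple] set0.
have gP l : past_boxes (g l).
  rewrite /g; case: unpickle => [e|]; first exact: cover_box_past.
  by exists 0%N, (fun=> set0), [tuple], [tuple], set0; split=> // -[].
move=> EP.
apply: (g_sigma_algebra_measure_unique past_boxes past_boxes_measurable g gP _
  (mrestr P mS) (mscale (NngNum (single_prob_ge0 i j)) P)) => //.
- apply/seteqP; split=> // w _; have [e we] := cover_boxP w.
  by exists (pickle e) => //; rewrite /g pickleK.
- move=> _ [k [J [s [q [C [mJ hJ sJ mC ->]]]]]].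
  exact: prob_single_cells.
- move=> l; rewrite /= /mrestr; apply: le_lt_trans (ltry 1).
  apply: probability_le1; apply: measurableI => //; exact: past_boxes_measurable.
Qed.

(** The key probabilistic fact: any event determined by the seed and by the
    customers up to [tau], routes included, is independent of the next window
    containing exactly one customer, of type [i] and routed to [j]. *)
Lemma past_event_independent (S : Z -> seq (customer R m n) -> Prop) i j :
  (forall k s (q : k.-tuple (option 'I_m)),
     measurable [set y : Z * k.-tuple R | S y.1 (customers y.2 s q)]) ->
  P ([set w | S (seed w) (Y w)] `&` single_arrival i j) =
  ((single_prob i j)%:E * P [set w | S (seed w) (Y w)])%E.
Proof.
move=> mS; apply: past_algebra_independent.
apply: (@data_measurable R m n _ (g_sigma_algebraType past_boxes) Y _ Z seed) => //.
by move=> _ C mC; rewrite setTI; exact: past_seed.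
Qed.

End independent_increments.

(** * Windows with few expected arrivals *)

Section partition.
Context (R : realType) (m n : nat) (I : instance R m n).
Local Notation T := (horizon I).

Lemma span_neg tau : tau < 0 -> span I tau = set0.
Proof.
move=> t0; apply/seteqP; split=> // y [] /=; rewrite in_itv /= => /andP[y0 _] yt.
by have := le_lt_trans (le_trans y0 yt) t0; rewrite ltxx.
Qed.

Lemma span_full tau : T <= tau -> span I tau = `[0, T]%classic.
Proof.
move=> Tt; apply/seteqP; split=> y; first by case.
by move=> yT; split=> //=; move: yT; rewrite /= in_itv /= => /andP[_ /le_trans]; exact.
Qed.

Lemma span_itv tau : tau <= T -> span I tau = `[0, tau]%classic.
Proof.
move=> tT; apply/seteqP; split=> y; rewrite /span /= !in_itv /=.
  by case=> /andP[-> _] ->.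
by case/andP=> y0 yt; split=> //; rewrite y0 (le_trans yt).
Qed.

Lemma mean_arrivals_set0 i : mean_arrivals I i set0 = 0.
Proof. exact: Rintegral_set0. Qed.

Lemma mass_set0 : mass I set0 = 0.
Proof. by apply: big1 => i _; exact: mean_arrivals_set0. Qed.

Lemma mass_ge0 (B : set R) : B `<=` `[0, T] -> 0 <= mass I B.
Proof. by move=> BT; apply: sumr_ge0 => i _; exact: mean_arrivals_ge0. Qed.

Lemma mass_span_mono tau tau' : tau <= tau' -> mass I (span I tau) <= mass I (span I tau').
Proof.
move=> tt; rewrite (mass_window I tt) lerDl; apply: mass_ge0 => y [[]] //.
Qed.

Lemma within_continuous_sum (J : Type) (s : seq J) (A : set R) (F : J -> R -> R) :
  (forall a, {within A, continuous (F a)}) ->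
  {within A, continuous (fun t => \sum_(a <- s) F a t)}.
Proof.
move=> cF; elim: s => [|a s IH] t.
  rewrite (_ : (fun _ => _) = cst 0); first exact: cvg_cst.
  by apply/funext => y; rewrite big_nil.
rewrite (_ : (fun _ => _) = (fun y => F a y + \sum_(b <- s) F b y)); last first.
  by apply/funext => y; rewrite big_cons.
by apply: cvgD; [exact: cF|exact: IH].
Qed.

Lemma mass_span_continuous : {within `[0, T], continuous (fun t => mass I (span I t))}.
Proof.
have cont := @within_continuous_sum _ (index_enum 'I_n) `[0, T]%classic
  (fun i t => parameterized_integral (@lebesgue_measure R) 0 t (rate I i)) _.
apply: (subspace_eq_continuous _ (cont _)).
  move=> t tT /=; apply: eq_bigr => i _; rewrite span_itv //.
  by move: tT; rewrite inE /= in_itv /= => /andP[].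
by move=> i; apply: parameterized_integral_continuous; [exact: horizon_ge0|exact: rate_integrable].
Qed.

(** The expected number of arrivals up to time t is a continuous function of t,
    so it can be divided into equal parts by the intermediate value theorem. The
    first cut is negative in order that nothing has arrived by then. *)
Lemma fine_partition (delta : R) : 0 < delta ->
  exists q (tau : nat -> R),
  [/\ tau 0%N < 0, T <= tau q, forall l, (l < q)%N -> tau l <= tau l.+1
    & forall l, (l < q)%N -> mass I (window I (tau l) (tau l.+1)) <= delta].
Proof.
move=> d0; pose F t := mass I (span I t); pose L := F T.
have FN1 : F (-1) = 0 by rewrite /F span_neg ?mass_set0 //; lra.
have F0 t : 0 <= F t by apply: mass_ge0 => y [].
have [L0|Lpos] := leP L 0.
  exists 1%N, (fun l => if l is 0%N then -1 else T); split=> //=.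
    by move=> [|l] //= _; apply: le_trans (horizon_ge0 I); lra.
  move=> [|l] //= _.
  have N1T : -1 <= T by apply: le_trans (horizon_ge0 I); lra.
  have := mass_window I N1T; have e1 : mass I (span I (-1)) = 0 := FN1.
  by have e2 : mass I (span I T) <= 0 := L0; lra.
pose q := Num.bound (L / delta).
have qb : L / delta < q%:R by apply: archi_boundP; apply: divr_ge0; lra.
have q0 : 0 < q%:R :> R by apply: le_lt_trans qb; apply: divr_ge0; lra.
have Lq : L / q%:R <= delta by rewrite ler_pdivrMr // mulrC -ler_pdivrMr // ltW.
(* the cut number [l] is where the fraction l/q of the expected arrivals is reached *)
have ex l : exists t, [/\ -1 <= t <= T, (l = 0%N -> t = -1), (l = q -> t = T) &
    (l <= q)%N -> F t = l%:R * (L / q%:R)].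
  have N1T : -1 <= T by apply: le_trans (horizon_ge0 I); lra.
  have qn0 : q <> 0%N by move=> e; move: q0; rewrite e ltxx.
  have [->|l0] := eqVneq l 0%N.
    by exists (-1); rewrite lexx N1T FN1 mul0r; split.
  have [->|lq] := eqVneq l q.
    exists T; rewrite lexx N1T; split=> // _.
    by rewrite mulrC divfK // gt_eqF.
  have [lleq|] := leqP l q; last first.
    move=> ql; exists T; rewrite lexx N1T; split=> // l00.
    by move: l0; rewrite l00.
  have F00 : F 0 <= l%:R * (L / q%:R).
    have -> : F 0 = 0.
      apply: big1 => i _; rewrite span_itv ?horizon_ge0 // set_itv1.
      exact: Rintegral_set1.
    by do ?apply: mulr_ge0; rewrite ?invr_ge0 ?ler0n //; lra.
  have FTl : l%:R * (L / q%:R) <= F T.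
    rewrite -/L mulrA ler_pdivrMr // mulrC ler_pM2l // ler_nat //.
  have [t] := IVT (horizon_ge0 I) mass_span_continuous
    (v := l%:R * (L / q%:R)) ltac:(by rewrite ge_min F00 /= le_max FTl orbT).
  rewrite in_itv /= => /andP[t0 tT] Ft; exists t; split=> //.
  - by rewrite tT andbT; lra.
  - by move/eqP: l0.
  - by move/eqP: lq.
have [tau tauP] := choice ex.
have tauF l : (l <= q)%N -> F (tau l) = l%:R * (L / q%:R) by have [] := tauP l.
have step l : (l < q)%N -> F (tau l.+1) - F (tau l) = L / q%:R.
  by move=> lq; rewrite !tauF ?(ltnW lq) // -natr1; ring.
have mono l : (l < q)%N -> tau l <= tau l.+1.
  move=> lq; rewrite leNgt; apply/negP => lt.
  have le : F (tau l.+1) <= F (tau l) := mass_span_mono (ltW lt).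
  have pos : 0 < L / q%:R by exact: divr_gt0.
  by have := step l lq; lra.
exists q, tau; split=> //.
- by have [_ -> //] := tauP 0%N; lra.
- by have [_ _ -> //] := tauP q.
- move=> l lq; have := step l lq.
  by rewrite /F (mass_window I (mono l lq)); lra.
Qed.

End partition.

(** * The algorithm *)

Section algorithm_facts.
Context (R : realType) (m n : nat) (I : instance R m n).
Context (r z : R) (x : 'I_n -> 'I_m -> R).
Context d' (Z : measurableType d') (share : sharing_rule R m n Z).
Hypothesis share_valid : sharing_rule_valid share.

Local Notation c := (capacity I).
Local Notation u := (usage I).
Local Notation run zeta s := (RLS I r z x share zeta s).
Local Notation can := (can_take I r z x).
Implicit Types (zeta : Z) (s : seq (customer R m n)) (a : customer R m n).

Lemma RLS_from_cat zeta used hist s1 s2 :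
  RLS_from I r z x share zeta used hist (s1 ++ s2) =
  RLS_from I r z x share zeta (RLS_from I r z x share zeta used hist s1) (hist ++ s1) s2.
Proof.
elim: s1 used hist => [|a s1 IH] used hist /=; first by rewrite cats0.
by rewrite IH cat_rcons.
Qed.

Lemma RLS_step zeta s a : run zeta (s ++ [:: a]) =
  allocate I (run zeta s) (customer_type a)
    (assigned_to I r z x share zeta (run zeta s) (s ++ [:: a]) a).
Proof. by rewrite /RLS RLS_from_cat /= cats1. Qed.

(** Sharing obeys the same rule as admission, so customers brought in by sharing
    satisfy the size bounds of the admissible ones. *)
Lemma assigned_can_take zeta used hist a j :
  assigned_to I r z x share zeta used hist a = Some j -> can used (customer_type a) j.
Proof.
have sharedP o :
    (let E := [set j' | can used (customer_type a) j' & Some j' != o]%SET in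
     if E != finset.set0 then Some (share zeta hist E) else None) = Some j ->
    can used (customer_type a) j.
  move=> /=; case: ifP => // E0 [<-]; have := share_valid zeta hist E0.
  by rewrite inE => /andP[].
rewrite /assigned_to; case: (routed_to a) => [j0|]; last exact: sharedP.
by case: ifP => [cj0 [<-] //|_]; exact: sharedP.
Qed.

Lemma RLS_step_ge zeta s a j : run zeta s j <= run zeta (s ++ [:: a]) j.
Proof.
rewrite RLS_step ffunE lerDl; case: ifP => // _.
by have /andP[] := usage_bounds I (customer_type a) j.
Qed.

Lemma RLS_mono zeta s s' j : run zeta s j <= run zeta (s ++ s') j.
Proof.
elim/last_ind: s' => [|s' a IH]; first by rewrite cats0.
by rewrite -cats1 catA; apply: le_trans IH (RLS_step_ge _ _ _ _).
Qed.

Lemma RLS_ge0 zeta s j : 0 <= run zeta s j.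
Proof. by have := RLS_mono zeta [::] s j; rewrite /= /RLS /= ffunE. Qed.

Lemma RLS_le_capacity zeta s j : run zeta s j <= c j.
Proof.
elim/last_ind: s => [|s a IH]; first by rewrite /RLS /= ffunE ltW // capacity_gt0.
rewrite -cats1 RLS_step ffunE; case: eqP => [/assigned_can_take /andP[_]|_].
  by rewrite -lerBrDl.
by rewrite addr0.
Qed.

Lemma RLS_accept zeta s a j : routed_to a = Some j ->
  can (run zeta s) (customer_type a) j ->
  run zeta (s ++ [:: a]) j = run zeta s j + u (customer_type a) j.
Proof.
by move=> aj cj; rewrite RLS_step ffunE /assigned_to aj cj eqxx.
Qed.

Lemma admissible_usage_ge i j : z <= 2^-1 -> ~~ type_A I r z x j ->
  admissible I r z x i j -> z * c j <= u i j.
Proof.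
move=> z2 nA; rewrite /admissible (negbTE nA) /= !inE => /orP[/andP[_ ->//]|].
by have := capacity_gt0 I j; nra.
Qed.

(** A resource of type B admits only customers of size at least [z * c j], so it
    is either unused or filled at least to that level. *)
Lemma RLS_gap zeta s j : z <= 2^-1 -> ~~ type_A I r z x j ->
  run zeta s j = 0 \/ z * c j <= run zeta s j.
Proof.
move=> z2 nA; elim/last_ind: s => [|s a IH]; first by left; rewrite /RLS /= ffunE.
rewrite -cats1 RLS_step ffunE; case: eqP => [/assigned_can_take /andP[adm _]|_].
  right; apply: le_trans (admissible_usage_ge z2 nA adm) _.
  by rewrite lerDr RLS_ge0.
by rewrite addr0.
Qed.

Hypothesis share_meas : sharing_rule_measurable share.

Let used k (s : k.-tuple 'I_n) (q : k.-tuple (option 'I_m)) j (y : Z * k.-tuple R) :=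
  run y.1 (customers y.2 s q) j.

Let measurable_can k (s : k.-tuple 'I_n) (q : k.-tuple (option 'I_m)) i j :
  measurable_fun setT (used s q j) ->
  measurable [set y | can (run y.1 (customers y.2 s q)) i j].
Proof.
move=> mD; rewrite /can_take; case: (admissible _ _ _ _ i j) => /=; last first.
  by rewrite (_ : mkset _ = set0) //; apply/seteqP; split.
rewrite (_ : mkset _ = used s q j @^-1` `]-oo, c j - u i j]).
  by rewrite -[X in measurable X]setTI; apply: mD => //; exact: measurable_itv.
by apply/seteqP; split=> y /=; rewrite in_itv /= /used lerBrDl -lerBrDr.
Qed.

(** The last customer is treated according to finitely many alternatives, each
    measurable: whether the routed resource can take it, which set of resources
    is offered to the sharing rule, and what the rule answers. Induction on the
    number of customers. *)
Lemma RLS_measurable k (s : k.-tuple 'I_n) (q : k.-tuple (option 'I_m)) j :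
  measurable_fun setT (fun y : Z * k.-tuple R => run y.1 (customers y.2 s q) j).
Proof.
elim: k s q j => [|k IH].
  move=> s q j.
  rewrite (_ : (fun _ => _) = cst 0); first exact: measurable_cst.
  apply/funext => y; rewrite /= (size0nil (size_customers y.2 s q)).
  by rewrite /RLS /= ffunE.
rewrite -addn1 => s q j.
pose i := tnth (tright s) ord0; pose o := tnth (tright q) ord0.
pose prev (y : Z * (k + 1).-tuple R) : Z * k.-tuple R := (y.1, tleft y.2).
have mprev : measurable_fun setT prev.
  apply: measurable_fun_pair; first exact: measurable_fst.
  by apply: measurableT_comp; [exact: measurable_tleft|exact: measurable_snd].
pose D (y : Z * (k + 1).-tuple R) := run y.1 (customers (tleft y.2) (tleft s) (tleft q)).
have mD j' : measurable_fun setT (fun y => D y j').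
  have -> : (fun y => D y j') = (used (tleft s) (tleft q) j') \o prev by [].
  by apply: measurableT_comp => //; exact: IH.
have mcan j' : measurable [set y | can (D y) i j'].
  rewrite (_ : mkset _ = prev @^-1` [set y | can (run y.1 (customers y.2 (tleft s) (tleft q))) i j']) //.
  rewrite -[X in measurable X]setTI; apply: mprev => //; apply: measurable_can.
  exact: IH.
(* the resources that can share the last customer, and whether it is admitted
   directly *)
pose E y := [set j' | can (D y) i j' & Some j' != o]%SET.
have mE A : measurable [set y | E y = A].
  rewrite (_ : mkset _ = \bigcap_(j' in [set: 'I_m])
     [set y | can (D y) i j' && (Some j' != o) = (j' \in A)]); last first.
    apply/seteqP; split=> y /=; first by move=> <- j' _; rewrite /= inE.
    by move=> h; apply/setP => j'; rewrite inE; exact: (h j' Logic.I).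
  apply: fin_bigcap_measurable; first exact: finite_finset.
  move=> j' _; case: (Some j' != o); case: (j' \in A).
  - by rewrite (_ : mkset _ = [set y | can (D y) i j']) //; apply/seteqP; split=> y /=; rewrite andbT.
  - rewrite (_ : mkset _ = ~` [set y | can (D y) i j']); first exact: measurableC.
    by apply/seteqP; split=> y /=; rewrite andbT; case: can.
  - by rewrite (_ : mkset _ = set0) //; apply/seteqP; split=> y //=; rewrite andbF.
  - by rewrite (_ : mkset _ = setT) //; apply/seteqP; split=> y //=; rewrite andbF.
pose direct y := if o is Some j0 then can (D y) i j0 else false.
have mdirect : measurable [set y | direct y].
  rewrite /direct; case: (o) => [j0|]; first exact: mcan.
  by rewrite (_ : mkset _ = set0) //; apply/seteqP; split.
pose S := [set y | if direct y then o == Some j else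
   (E y != finset.set0) && (share y.1 (customers y.2 s q) (E y) == j)].
have mS : measurable S.
  rewrite (_ : S = ([set y | direct y] `&` [set y | o == Some j]) `|`
    (~` [set y | direct y] `&` \bigcup_(A : {set 'I_m}) ([set y | E y = A] `&`
      [set y | (A != finset.set0) /\ share y.1 (customers y.2 s q) A = j]))).
    apply: measurableU.
      apply: measurableI => //; case: (o == Some j).
        by rewrite (_ : mkset _ = setT) //; apply/seteqP; split.
      by rewrite (_ : mkset _ = set0) //; apply/seteqP; split.
    apply: measurableI; first exact: measurableC.
    apply: fin_union_measurable => A; apply: measurableI; first exact: mE.
    case: (A != finset.set0).
      rewrite (_ : mkset _ = [set y : Z * (k + 1).-tuple R | share y.1 (customers y.2 s q) A = j]).
        exact: share_meas.
      by apply/seteqP; split=> y /=; [case|].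
    by rewrite (_ : mkset _ = set0) //; apply/seteqP; split=> y //= [].
  apply/seteqP; split=> y; rewrite /S /=.
    case: ifP => dy; first by left.
    by move=> /andP[E0 /eqP Ej]; right; split=> //; exists (E y).
  case=> [[-> ->]//|[/negP /negbTE -> [A _ [EA [A0 Aj]]]]].
  by rewrite EA A0 Aj eqxx.
rewrite (_ : (fun _ => _) = (fun y => D y j + u i j * \1_S y)).
  apply: measurable_funD; first exact: mD.
  apply: measurable_funM; first exact: measurable_cst.
  by apply: measurable_indic.
apply/funext => y.
pose a := Customer (tnth (tright y.2) ord0) i o.
have ysplit : customers y.2 s q = customers (tleft y.2) (tleft s) (tleft q) ++ [:: a].
  rewrite -{1}(tsplitK y.2) -{1}(tsplitK s) -{1}(tsplitK q) customers_cat.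
  by congr (_ ++ _); rewrite /customers enum_ordSl enum_ord0.
rewrite ysplit RLS_step ffunE -/(D y) -ysplit; congr (_ + _); rewrite indicE.
have -> : (y \in S) = (if direct y then o == Some j else
   (E y != finset.set0) && (share y.1 (customers y.2 s q) (E y) == j)).
  by apply/idP/idP => [/set_mem|/mem_set].
have -> : (assigned_to I r z x share y.1 (D y) (customers y.2 s q) a == Some j) =
  (if direct y then o == Some j else
   (E y != finset.set0) && (share y.1 (customers y.2 s q) (E y) == j)).
  rewrite /assigned_to /= -/i -/(E y) /direct.
  have sharedE : ((if E y != finset.set0 then Some (share y.1 (customers y.2 s q) (E y))
      else None) == Some j) =
      (E y != finset.set0) && (share y.1 (customers y.2 s q) (E y) == j).
    by case: (E y != finset.set0).
  case: (o) => [j0|]; last exact: sharedE.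
  have [_ //|_] := boolP (can (D y) i j0); exact: sharedE.
have ifE (b : bool) (v : R) : (if b then v else 0) = v * b%:R.
  by case: b; rewrite ?mulr1 ?mulr0.
exact: ifE.
Qed.

End algorithm_facts.

(** * Expectations of bounded random variables *)

Section bounded_random_variables.
Context (R : realType) d (Omega : measurableType d) (P : probability Omega R).
Implicit Types (f g : Omega -> R) (A : set Omega).

Definition bounded_rv f : Prop :=
  measurable_fun setT f /\ exists M, forall w, `|f w| <= M.

Lemma bounded_rv_integrable f : bounded_rv f -> P.-integrable setT (EFin \o f).
Proof.
move=> [mf [M fM]]; apply: measurable_bounded_integrable => //.
  by apply: le_lt_trans (ltry 1); apply: probability_le1.
by exists M; split; [exact: num_real|move=> y My w _; apply: le_trans (fM w) (ltW My)].
Qed.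

Lemma bounded_rvD f g : bounded_rv f -> bounded_rv g -> bounded_rv (fun w => f w + g w).
Proof.
move=> [mf [M fM]] [mg [M' gM]]; split; first exact: measurable_funD.
by exists (M + M') => w; apply: le_trans (ler_normD _ _) _; exact: lerD.
Qed.

Lemma bounded_rv_indic (v : R) A : measurable A -> bounded_rv (fun w => v * \1_A w).
Proof.
move=> mA; split.
  apply: measurable_funM; first exact: measurable_cst.
  by apply: measurable_indic.
exists `|v| => w; rewrite normrM indicE ler_piMr //.
by case: (w \in A); rewrite ?normr1 ?normr0.
Qed.

Lemma Rintegral_indic (v : R) A : measurable A ->
  \int[P]_w (v * \1_A w) = v * fine (P A).
Proof.
move=> mA; rewrite RintegralZl //; last first.
  by have := bounded_rv_integrable (bounded_rv_indic 1 mA); under eq_fun do rewrite /= mul1r.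
by rewrite /Rintegral integral_indic // setIT.
Qed.

Lemma Rintegral_add_indics (T : Type) (s : seq T) f (v : T -> R) (A : T -> set Omega) :
  bounded_rv f -> (forall i, measurable (A i)) ->
  bounded_rv (fun w => f w + \sum_(i <- s) v i * \1_(A i) w) /\
  \int[P]_w (f w + \sum_(i <- s) v i * \1_(A i) w) =
  \int[P]_w f w + \sum_(i <- s) v i * fine (P (A i)).
Proof.
move=> bf mA; elim: s => [|i s [bs IH]].
  rewrite big_nil addr0; under eq_fun do rewrite big_nil addr0.
  by split=> //; apply: eq_Rintegral => w _; rewrite big_nil addr0.
have e w : f w + \sum_(i <- i :: s) v i * \1_(A i) w =
    (f w + \sum_(i <- s) v i * \1_(A i) w) + v i * \1_(A i) w.
  by rewrite big_cons; ring.
have bi := bounded_rv_indic (v i) (mA i).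
split; first by under eq_fun do rewrite e; exact: bounded_rvD.
rewrite (@eq_Rintegral _ _ _ P setT (fun w => (f w + \sum_(i <- s) v i * \1_(A i) w) + v i * \1_(A i) w)) //.
rewrite RintegralD //; [|exact: bounded_rv_integrable..].
by rewrite IH Rintegral_indic // big_cons; ring.
Qed.

Lemma bounded_rv_le f g : bounded_rv f -> bounded_rv g -> (forall w, f w <= g w) ->
  \int[P]_w f w <= \int[P]_w g w.
Proof. by move=> bf bg fg; apply: le_Rintegral => //; exact: bounded_rv_integrable. Qed.

Lemma markov_le f (b : R) : 0 < b -> bounded_rv f -> (forall w, 0 <= f w) ->
  1 - (\int[P]_w f w) / b <= fine (P [set w | f w <= b]).
Proof.
move=> b0 bf f0; have [mf _] := bf.
have mA : measurable [set w | f w <= b].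
  rewrite (_ : mkset _ = f @^-1` `]-oo, b]).
    by rewrite -[X in measurable X]setTI; apply: mf => //; exact: measurable_itv.
  by apply/seteqP; split=> w /=; rewrite in_itv.
have [b1 e1] := @Rintegral_add_indics _ [:: tt] f (fun=> b) (fun=> [set w | f w <= b]) bf (fun=> mA).
have bc : bounded_rv (cst b : Omega -> R).
  by split; [exact: measurable_cst|exists `|b|].
have ib : \int[P]_w cst b w = b.
  rewrite /Rintegral -[RHS]/(fine b%:E); congr fine.
  by have := expectation_cst P b; rewrite unlock.
have le : b <= \int[P]_w f w + b * fine (P [set w | f w <= b]).
  rewrite -{1}ib; have -> : b * fine (P [set w | f w <= b]) =
      \sum_(i <- [:: tt]) b * fine (P [set w | f w <= b]) by rewrite big_seq1.
  rewrite -e1; apply: bounded_rv_le => // w; rewrite big_seq1 indicE /=.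
  case: (leP (f w) b) => fb.
    by rewrite mem_set // mulr1 lerDr.
  by rewrite memNset ?mulr0 ?addr0 ?ltW //= leNgt fb.
rewrite lerBlDr -(ler_pM2l b0) mulr1 mulrDr [b * (_ / b)]mulrCA divff ?gt_eqF // mulr1.
by rewrite addrC.
Qed.

End bounded_random_variables.

(** * The use of one resource over time *)

Section resource_process.
Context (R : realType) (m n : nat) (I : instance R m n).
Context (r z : R) (x : 'I_n -> 'I_m -> R).
Context d (Omega : measurableType d) (P : probability Omega R).
Context (X : Omega -> seq (customer R m n)).
Context d' (Z : measurableType d') (seed : Omega -> Z) (share : sharing_rule R m n Z).
Hypothesis orderedX : arrivals_ordered I X.
Hypothesis measX : stream_measurable X.
Hypothesis poissonX : poisson_arrivals I P X.
Hypothesis mseed : measurable_fun setT seed.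
Hypothesis routX : routing_independent I x P X seed.
Hypothesis share_valid : sharing_rule_valid share.
Hypothesis share_meas : sharing_rule_measurable share.
Hypothesis x_ge0 : forall i j, 0 <= x i j.
Variable j : 'I_m.

Local Notation u i := (usage I i j).
Local Notation c := (capacity I j).

(** The amount of resource [j] in use at time [tau]. Running the algorithm on the
    customers up to [tau] gives the state at [tau] because the sharing rule sees
    only the history. *)
Definition used tau w : R := RLS I r z x share (seed w) (upto tau (X w)) j.

Let sortedX w : sorted (@earlier R m n) (X w).
Proof. by have [] := orderedX w. Qed.

Lemma measurable_used tau : measurable_fun setT (used tau).
Proof.
move=> _ B mB; rewrite setTI.
have mY := @stream_measurable_upto _ _ _ _ _ _ sortedX measX tau.
apply: (@data_measurable R m n _ Omega (fun w => upto tau (X w)) _ Z seed mseed _ _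
  (fun zeta s => B (RLS I r z x share zeta s j))).
- by move=> k s q; apply: mY; exact: measurableT.
- move=> k a Q s q mQ; apply: mY; rewrite -[X in measurable X]setTI.
  exact: measurable_tnth.
- move=> k s q; rewrite -[X in measurable X]setTI.
  exact: RLS_measurable.
Qed.

Lemma used_le tau tau' w : tau <= tau' -> used tau w <= used tau' w.
Proof.
move=> tt; rewrite /used -(upto_upto (X w) tt).
by rewrite {2}(upto_after tau (sorted_upto tau' (sortedX w))); exact: RLS_mono.
Qed.

Lemma used_neg tau w : tau < 0 -> used tau w = 0.
Proof.
move=> t0; rewrite /used /upto filter_none; first by rewrite /RLS /= ffunE.
apply/allP => a aX /=; rewrite -ltNge; apply: lt_le_trans t0 _.
by have /andP[] := arrival_timeP orderedX aX.
Qed.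

Lemma used_full tau w : horizon I <= tau -> used tau w = RLS I r z x share (seed w) (X w) j.
Proof.
move=> Tt; rewrite /used /upto (all_filterP _) //.
apply/allP => a aX; apply: le_trans Tt.
by have /andP[] := arrival_timeP orderedX aX.
Qed.

Lemma used_single tau tau' w i :
  single_arrival X tau tau' i j w ->
  admissible I r z x i j -> u i <= c - used tau w ->
  used tau' w = used tau w + u i.
Proof.
case=> a [Yw' _ ai aj] adm fits.
rewrite /used Yw' RLS_accept // ?ai //.
by rewrite /can_take adm.
Qed.

Lemma single_arrival_type tau tau' w i i' :
  single_arrival X tau tau' i j w -> single_arrival X tau tau' i' j w -> i = i'.
Proof.
case=> a [Yw _ <- _] [a' [+ _ <- _]]; rewrite Yw => /eqP.
by rewrite eqseq_cat // eqxx /= => /eqP[->].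
Qed.

Lemma measurable_used_le tau b : measurable [set w | used tau w <= b].
Proof.
rewrite (_ : mkset _ = used tau @^-1` `]-oo, b]).
  by rewrite -[X in measurable X]setTI; apply: measurable_used => //; exact: measurable_itv.
by apply/seteqP; split=> w /=; rewrite in_itv.
Qed.

Lemma prob_past_single tau tau' i (b : R) : tau <= tau' ->
  fine (P ([set w | used tau w <= b] `&` single_arrival X tau tau' i j)) =
  single_prob I x tau tau' i j * fine (P [set w | used tau w <= b]).
Proof.
move=> tt.
have PE := past_event_independent orderedX measX poissonX mseed routX tt x_ge0
  (S := fun zeta s => RLS I r z x share zeta s j <= b) i j.
rewrite -/(used tau) in PE.
rewrite PE; first by rewrite fineM // fin_num_measure //; exact: measurable_used_le.
move=> k s q.
rewrite (_ : mkset _ = (fun y : Z * k.-tuple R => RLS I r z x share y.1 (customers y.2 s q) j)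
  @^-1` `]-oo, b]).
  rewrite -[X in measurable X]setTI; apply: RLS_measurable => //; exact: measurable_itv.
by apply/seteqP; split=> y /=; rewrite in_itv.
Qed.

Definition fill_prob tau b : R := fine (P [set w | used tau w <= b]).

(** If [f] never decreases along the process and jumps by [g i] when, starting
    from a use of at most [b], the window brings a single customer of type [i]
    routed to [j], then the expectation of [f] grows by at least the expected
    jump. All other developments in the window, in particular several arrivals
    and all effects of sharing, are covered by monotonicity. *)
Lemma process_step tau tau' (f : R -> R) (M b : R) (Q : {set 'I_n}) (g : 'I_n -> R) :
  tau <= tau' ->
  measurable_fun setT f -> (forall y, 0 <= y <= c -> `|f y| <= M) ->
  (forall w, f (used tau w) <= f (used tau' w)) ->
  (forall i w, i \in Q -> used tau w <= b -> single_arrival X tau tau' i j w ->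
     f (used tau w) + g i <= f (used tau' w)) ->
  \int[P]_w f (used tau w) + fill_prob tau b * \sum_(i in Q) g i * single_prob I x tau tau' i j
    <= \int[P]_w f (used tau' w).
Proof.
move=> tt mf fM mono jump.
have bf t : bounded_rv (fun w => f (used t w)).
  split; first by apply: measurableT_comp => //; exact: measurable_used.
  exists M => w; apply: fM.
  by rewrite RLS_ge0 // RLS_le_capacity.
pose A i := [set w | used tau w <= b] `&` single_arrival X tau tau' i j.
have mA i : measurable (A i).
  by apply: measurableI; [exact: measurable_used_le|exact: measurable_single_arrival].
have [b1 e1] := Rintegral_add_indics P (enum Q) g (bf tau) mA.
have -> : fill_prob tau b * \sum_(i in Q) g i * single_prob I x tau tau' i j =
    \sum_(i <- enum Q) g i * fine (P (A i)).
  rewrite big_enum /= big_distrr /=; apply: eq_bigr => i _.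
  by rewrite prob_past_single // mulrC -mulrA; congr (_ * _); rewrite mulrC.
rewrite -e1; apply: bounded_rv_le => // w.
have [[i [iQ Aw]]|none] := pselect (exists i, i \in Q /\ A i w).
  rewrite (bigD1_seq i) ?mem_enum ?enum_uniq //= indicE mem_set // mulr1.
  rewrite big1 ?addr0; first by case: Aw; exact: jump.
  move=> i' ne; rewrite indicE memNset ?mulr0 // => -[_ Si'].
  by case: Aw => _ /(single_arrival_type Si') e; rewrite e eqxx in ne.
rewrite big_seq big1 ?addr0 // => i; rewrite mem_enum => iQ.
by rewrite indicE memNset ?mulr0 // => Aw; apply: none; exists i.
Qed.

End resource_process.

(** * Recursive inequalities *)

Section recursions.
Context (R : realType).
Implicit Types (b eps z : R) (e p v mm ww : nat -> R) (q : nat).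

(** With [p l >= 1 - e l / b] the missing amount [b - e l] is multiplied by at
    most [1 - eps * v l / b] in each step, as long as it is positive. *)
Lemma fill_recursion b eps q e p v : 0 < b -> 0 <= eps -> (forall l, 0 <= v l) ->
  0 <= e 0%N ->
  (forall l, 0 <= p l) -> (forall l, 1 - e l / b <= p l) ->
  (forall l, (l < q)%N -> e l + p l * (eps * v l) <= e l.+1) ->
  b * (1 - expR (- (eps * (\sum_(l < q) v l) / b))) <= e q.
Proof.
move=> b0 eps0 v0 e0 p0 pe; elim: q => [|q IH] step.
  by rewrite big_ord0 mulr0 mul0r oppr0 expR0 subrr mulr0.
have {}IH := IH (fun l lq => step l (ltnW lq)).
have {}step := step q (ltnSn q).
rewrite big_ord_recr /=; set S := \sum_(l < q) v l in IH *.
have -> : - (eps * (S + v q) / b) = - (eps * S / b) - eps * v q / b by ring.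
rewrite expRD; set E := expR (- (eps * S / b)) in IH *.
set y := eps * v q / b; have y0 : 0 <= y by rewrite /y !mulr_ge0 ?invr_ge0 // ltW.
have E0 : 0 < E by exact: expR_gt0.
have F1 : 1 - y <= expR (- y) by apply: expR_ge1Dx.
have F0 : 0 < expR (- y) by exact: expR_gt0.
have yb : eps * v q = y * b by rewrite /y divfK // gt_eqF.
have pb : b - e q <= b * p q.
  have := pe q; rewrite -(ler_pM2l b0) mulrBr mulr1 [b * (_ / _)]mulrCA divff ?gt_eqF //; lra.
rewrite yb in step.
have hstep : y * (b - e q) <= y * (b * p q) by apply: ler_wpM2l.
have pq0 := mulr_ge0 (p0 q) (mulr_ge0 y0 (ltW b0)).
have [hb|hb] := leP (b - e q) 0.
  have : 0 <= b * (E * expR (- y)) by rewrite !mulr_ge0 ?ltW.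
  lra.
have k1 : (b - e q) * (1 - y) <= (b - e q) * expR (- y) by rewrite ler_pM2l.
have k2 : (b - e q) * expR (- y) <= b * E * expR (- y) by rewrite ler_pM2r //; lra.
lra.
Qed.

(** With [eps = 1], remaining medium load [M] and remaining large load [W], this
    is [z] minus the value of an unused resource of unit capacity if every
    medium customer has size [1/2] but yields only [z], every large one yields
    [1/2], and all medium ones come before the large ones. Indeed that value is
    [z (1 - exp (- 2 M)) + exp (- 2 M) (1 - exp (- 2 W)) / 2]. *)
Definition floor_gap z (M W : R) (e : R) : R :=
  expR (- (2 * (e * M))) * (2^-1 * expR (- (2 * (e * W))) - (2^-1 - z)).

(** The value guaranteed to an unused resource, capped at [z]. The cap is what
    protects the bound from sharing: a shared customer makes the resource worth
    at least [z], whatever might have come later. *)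
Definition floor_value z eps M W : R := z - Num.max 0 (floor_gap z M W eps).

Lemma floor_value_itv z eps M W : 0 < z < 2^-1 -> 0 <= eps -> 0 <= M -> 0 <= W ->
  0 <= floor_value z eps M W <= z.
Proof.
move=> hz e0 M0 W0; rewrite /floor_value /floor_gap lerBlDr lerDl le_max lexx andbT.
rewrite subr_ge0 ge_max; apply/andP; split; first lra.
have E0 := expR_gt0 (- (2 * (eps * M))).
have E1 : expR (- (2 * (eps * M))) <= 1 by rewrite expR_le1 oppr_le0 !mulr_ge0.
have F1 : expR (- (2 * (eps * W))) <= 1 by rewrite expR_le1 oppr_le0 !mulr_ge0.
set E := expR _ in E0 E1 *; set F := expR _ in F1 *.
have [h|h] := leP (2^-1 * F - (2^-1 - z)) 0; nra.
Qed.

(** Adding an early medium load [mu] and large load [om] moves the value towards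
    [z] and towards [1/2] at twice these rates. The closed form, with the medium
    load first, is the least favourable order: the defect is governed by
    x - 1 + exp (- x), which is nonnegative and increasing. *)
Lemma floor_value_step z eps M W mu om : 0 < z < 2^-1 -> 0 <= eps ->
  0 <= M -> 0 <= W -> 0 <= mu -> 0 <= om ->
  floor_value z eps (mu + M) (om + W) <=
  floor_value z eps M W + eps * (2 * (z - floor_value z eps M W) * mu +
    (1 - 2 * floor_value z eps M W) * om).
Proof.
move=> hz e0 M0 W0 mu0 om0; rewrite /floor_value /floor_gap.
have -> : - (2 * (eps * (mu + M))) = - (2 * (eps * M)) - 2 * (eps * mu) by ring.
have -> : - (2 * (eps * (om + W))) = - (2 * (eps * W)) - 2 * (eps * om) by ring.
rewrite !expRD.
have E0 := expR_gt0 (- (2 * (eps * M))).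
have E1 : expR (- (2 * (eps * M))) <= 1 by rewrite expR_le1 oppr_le0 !mulr_ge0.
have F0 := expR_gt0 (- (2 * (eps * W))).
set E := expR (- (2 * (eps * M))) in E0 E1 *; set F := expR (- (2 * (eps * W))) in F0 *.
have a0 : 0 <= 2 * (eps * mu) by rewrite !mulr_ge0.
have b0 : 0 <= 2 * (eps * om) by rewrite !mulr_ge0.
set a := 2 * (eps * mu) in a0 *; set b := 2 * (eps * om) in b0 *.
have ea := expR_ge1Dx (- a); have eb := expR_ge1Dx (- b).
have ea1 : expR (- a) <= 1 by rewrite expR_le1 oppr_le0.
have eb1 : expR (- b) <= 1 by rewrite expR_le1 oppr_le0.
have ea0 := expR_gt0 (- a); have eb0 := expR_gt0 (- b).
set ka := expR (- a) in ea ea1 ea0 *; set kb := expR (- b) in eb eb1 eb0 *.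
set B := 2^-1 - z; have B0 : 0 < B by rewrite /B; lra.
set Y := Num.max 0 (E * (2^-1 * F - B)).
have -> : z - Y + eps * (2 * (z - (z - Y)) * mu + (1 - 2 * (z - Y)) * om) =
  z - Y + a * Y + b * (B + Y) by rewrite /a /b /B; field.
suff : Y * (1 - a - b) - b * B <= Num.max 0 (E * ka * (2^-1 * (F * kb) - B)) by lra.
rewrite le_max /Y; have [h|h] := leP (E * (2^-1 * F - B)) 0.
  by apply/orP; left; have := mulr_ge0 b0 (ltW B0); lra.
apply/orP; right.
have AB : 0 < 2^-1 * F - B by rewrite -(pmulr_rgt0 _ E0).
have phia : 0 <= ka - 1 + a by lra.
have phiab : ka - 1 + a <= ka * kb - 1 + a + b.
  have : ka * (1 - kb) <= 1 - kb by rewrite ler_piMl //; lra.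
  lra.
have p1 : 0 <= E * (2^-1 * F * (ka * kb - 1 + a + b) - B * (ka - 1 + a)).
  apply: mulr_ge0; first exact: ltW.
  have q1 : B * (ka - 1 + a) <= 2^-1 * F * (ka - 1 + a) by apply: ler_wpM2r => //; lra.
  have q2 : 2^-1 * F * (ka - 1 + a) <= 2^-1 * F * (ka * kb - 1 + a + b) by apply: ler_wpM2l => //; lra.
  lra.
have E1' : 0 <= 1 - E by lra.
have p2 := mulr_ge0 (mulr_ge0 b0 (ltW B0)) E1'.
have -> : E * ka * (2^-1 * (F * kb) - B) =
  E * (2^-1 * F * (ka * kb - 1 + a + b) - B * (ka - 1 + a)) + E * (2^-1 * F - B) * (1 - a - b)
  - E * (b * B) by ring.
lra.
Qed.

(** Here [e] is the expected use, [p] the probability that the resource is unused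
    and [V] the value promised to an unused resource. The hypothesis says that a
    promise at the end of a step can be exchanged for a larger one at its
    beginning; starting from the promise [0] at the end, the promises
    [floor_value] are reached backwards in time. *)
Lemma stopping_recursion z eps q e p mm ww : 0 < z < 2^-1 -> 0 <= eps ->
  (forall l, 0 <= mm l) -> (forall l, 0 <= ww l) -> (forall l, 0 <= p l) ->
  (forall l V, (l < q)%N -> 0 <= V <= z ->
    e l + p l * (V + eps * (2 * (z - V) * mm l + (1 - 2 * V) * ww l))
      <= e l.+1 + p l.+1 * V) ->
  e 0%N + p 0%N * floor_value z eps (\sum_(l < q) mm l) (\sum_(l < q) ww l) <= e q.
Proof.
move=> hz eps0; elim: q e p mm ww => [|q IH] e p mm ww mm0 ww0 p0 step.
  rewrite !big_ord0 /floor_value /floor_gap !mulr0 oppr0 expR0 max_r; lra.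
have := IH (e \o S) (p \o S) (mm \o S) (ww \o S) (fun l => mm0 _) (fun l => ww0 _)
  (fun l => p0 _) (fun l V lq => step l.+1 V lq).
rewrite /= !big_ord_recl /=.
have sm : 0 <= \sum_(l < q) mm l.+1 by apply: sumr_ge0.
have sw : 0 <= \sum_(l < q) ww l.+1 by apply: sumr_ge0.
have vi := floor_value_itv hz eps0 sm sw.
have vs := floor_value_step hz eps0 sm sw (mm0 0%N) (ww0 0%N).
have := step 0%N _ (ltn0Sn q) vi.
set V' := floor_value z eps _ _ in vs vi *; set V := floor_value z eps _ _ in vs *.
move=> h1 h2; apply: le_trans h2; apply: le_trans h1; rewrite lerD2l.
by apply: ler_wpM2l.
Qed.

Lemma le_left_limit (F : R -> R) (C : R) : continuous F ->
  (forall t, 0 < t < 1 -> F t <= C) -> F 1 <= C.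
Proof.
move=> cF FC; rewrite leNgt; apply/negP => lt.
have h : \forall t \near (1 : R)^'-, C < F t.
  exact: (cvgr_gt (F 1) (cvg_at_left_filter (cF 1)) _ lt).
have [t [Ct /andP[t0 t1]]] : exists t, C < F t /\ 0 < t < 1.
  apply: (@filter_ex _ (1 : R)^'-); near=> t; split; first by near: t.
  apply/andP; split; near: t; [exact: nbhs_left_gt|exact: nbhs_left_lt].
by have := FC t; rewrite t0 t1 leNgt Ct => /(_ isT).
Unshelve. all: by end_near.
Qed.

Lemma continuous_of_is_derive (F dF : R -> R) :
  (forall t : R, is_derive t 1 F (dF t)) -> continuous F.
Proof.
by move=> dFP t; apply: differentiable_continuous; apply/derivable1_diffP; apply: ex_derive.
Qed.

Lemma fill_continuous b V : b != 0 ->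
  continuous (fun e : R => b * (1 - expR (- (e * V / b)))).
Proof.
move=> b0.
have dF (t : R) : is_derive t 1 (fun e : R => b * (1 - expR (- (e * V / b))))
    (V * expR (- (t * V / b))).
  by apply: is_derive_eq; rewrite /GRing.scale /=; field.
exact: continuous_of_is_derive dF.
Qed.

Lemma floor_gap_continuous z (M W C : R) : continuous (fun e : R => C * (z - floor_gap z M W e)).
Proof.
have dF (t : R) : is_derive t 1 (fun e : R => C * (z - floor_gap z M W e))
    (C * (2 * M * floor_gap z M W t + W * expR (- (2 * (t * M))) * expR (- (2 * (t * W))))).
  by rewrite /floor_gap; apply: is_derive_eq; rewrite /GRing.scale /=; field.
exact: continuous_of_is_derive dF.
Qed.

End recursions.

(** * An inequality between exponentials *)

Section analysis.
Context (R : realType).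
Implicit Types r z k u v w : R.

(** Apply 1 + x <= exp x at [u - k u] and at [- k u], with weights [k] and
    [1 - k]: the linear terms cancel. *)
Lemma expR_convex_lt k u : 0 < k < 1 -> u != 0 ->
  expR (k * u) < k * expR u + (1 - k).
Proof.
move=> /andP[k0 k1] u0.
have p1 : 1 + (u - k * u) <= expR (u - k * u) by exact: expR_ge1Dx.
have p2 : 1 + - (k * u) < expR (- (k * u)).
  by apply: expR_gt1Dx; rewrite oppr_eq0 mulf_neq0 // gt_eqF.
have : 1 < k * expR (u - k * u) + (1 - k) * expR (- (k * u)) by nra.
have e1 : expR (k * u) * expR (u - k * u) = expR u by rewrite -expRD addrC subrK.
have e2 : expR (k * u) * expR (- (k * u)) = 1 by rewrite -expRD subrr expR0.
by rewrite -(ltr_pM2l (expR_gt0 (k * u))) mulr1; nra.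
Qed.

(** The sign of the derivative changes at most once, from positive to negative,
    so the minimum over the interval is attained at an endpoint. Otherwise the
    mean value theorem would give a negative slope followed by a positive one. *)
Lemma ge_endpoints (f df N : R -> R) (a b c y : R) :
  a <= y <= b ->
  (forall t : R, is_derive t 1 f (df t)) ->
  (forall t, a < t < b -> 0 < df t -> 0 < N t) ->
  (forall t, a < t < b -> df t < 0 -> N t < 0) ->
  (forall s t, a < s -> s < t -> t < b -> N t <= N s) ->
  c <= f a -> c <= f b -> c <= f y.
Proof.
move=> /andP[ay yb] fdf Np Nn Nmono fa fb; rewrite leNgt; apply/negP => fy.
have cf := continuous_of_is_derive fdf.
have ay' : a < y.
  by rewrite lt_neqAle ay andbT; apply/eqP => ya; move: fa fy; rewrite ya; lra.
have yb' : y < b.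
  by rewrite lt_neqAle yb andbT; apply/eqP => ya; move: fb fy; rewrite ya; lra.
have [|c1 + e1] := @MVT R f df a y ay'; first exact: continuous_subspaceT.
have [|c2 + e2] := @MVT R f df y b yb'; first exact: continuous_subspaceT.
rewrite !in_itv /= => /andP[yc2 c2b] /andP[ac1 c1y].
have d1 : df c1 < 0 by nra.
have d2 : 0 < df c2 by nra.
have n1 : N c1 < 0 by apply: Nn => //; lra.
have n2 : 0 < N c2 by apply: Np => //; lra.
by have := @Nmono c1 c2 ac1 ltac:(lra) c2b; lra.
Qed.

(** The inequality of interest is
    exp (- 2 y) / 2 - (1/2 - z) (1 - 2 r y) <= (z - r y) (1 - r y / b) ^ (2 b)
    for [0 <= y <= 1], with [b = 1 - z] and [k = 2 b - 1 = 1 - 2 z]. It is an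
    equality at [y = 0] and is given at [y = 1]. After multiplication by exp (2 y)
    it says that a certain function is at least 1/2. In the variable v with
    exp (- v) = 1 - r y / b this function, [scaled], is a combination of
    exponentials, and [slope] is its derivative up to a positive factor. *)
Section gap.
Variables r b : R.
Let k := 2 * b - 1.

Let slope v := 2 * b * expR (- ((2 * b + 1) * v))
  - (2 * k + r + 2 * r * b) * expR (- (2 * b * v))
  + 2 * r * k * expR (- (k * v)) + 2 * b * k * expR (- v) - k ^+ 2 - r * k.

(** The derivative of [slope], divided by the positive number
    2 b exp (- (2 b) v), is at most (2 b + 1) (r - exp (- v)) + k, where
    exp (- v) >= 1 - r / b. That this is nonpositive is where [r <= 1 / 3]
    enters: (2 b + 1) (1 - r - r / b) >= 2 b - 1 is implied by its case r = 1/3,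
    which reads b <= 1. *)
Lemma slope_mono : 0 < r <= 1 / 3 -> 2^-1 < b < 1 ->
  forall s t, 0 < s -> s < t -> 1 - r / b <= expR (- t) -> slope t <= slope s.
Proof.
move=> /andP[r0 r3] /andP[b0 b1] s t s0 st ht.
pose dN v := - (2 * b * (2 * b + 1) * expR (- ((2 * b + 1) * v))
  - 2 * b * (2 * k + r + 2 * r * b) * expR (- (2 * b * v))
  + 2 * r * k ^+ 2 * expR (- (k * v)) + 2 * b * k * expR (- v)).
have dNP (v : R) : is_derive v 1 slope (dN v).
  rewrite /slope /dN; apply: is_derive_eq.
  by rewrite /GRing.scale /= /k; ring.
have cN := continuous_of_is_derive dNP.
have [|c + e] := @MVT R slope dN s t st; first exact: continuous_subspaceT.
rewrite in_itv /= => /andP[sc ct].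
suff : dN c <= 0 by nra.
have k0 : 0 < k by rewrite /k; lra.
have wc : 1 - r / b <= expR (- c).
  by apply: le_trans ht _; rewrite ler_expR; lra.
have -> : dN c = - (expR (- (k * c)) * (expR (- c)) * 2 * b * ((2 * b + 1) * expR (- c)
  - (2 * k + r + 2 * r * b)) + 2 * r * k ^+ 2 * expR (- (k * c)) + 2 * b * k * expR (- c)).
  rewrite /dN.
  have -> : - ((2 * b + 1) * c) = - (k * c) - c - c by rewrite /k; ring.
  have -> : - (2 * b * c) = - (k * c) - c by rewrite /k; ring.
  by rewrite !expRD; ring.
have E0 := expR_gt0 (- (k * c)).
have E1 : expR (- (k * c)) <= 1 by rewrite expR_le1; nra.
have w0 := expR_gt0 (- c).
set E := expR (- (k * c)) in E0 E1 *.
set w := expR (- c) in wc w0 *.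
have key : 0 <= (2 * b + 1) * w - k - r - 2 * r * b.
  have : (1 + 2 * b) * (1 - r - r / b) >= 2 * b - 1.
    have -> : (1 + 2 * b) * (1 - r - r / b) = (1 + 2 * b) * (1 - r * ((b + 1) / b)) by field; lra.
    have rb : r * ((b + 1) / b) <= (b + 1) / (3 * b).
      have -> : (b + 1) / (3 * b) = 1 / 3 * ((b + 1) / b) by field; lra.
      by apply: ler_wpM2r => //; apply: divr_ge0; lra.
    have : (1 + 2 * b) * (1 - (b + 1) / (3 * b)) >= 2 * b - 1.
      have -> : (1 + 2 * b) * (1 - (b + 1) / (3 * b)) = (1 + 2 * b) * (2 * b - 1) / (3 * b).
        by field; lra.
      by rewrite ler_pdivlMr; nra.
    nra.
  rewrite /k; nra.
have : 0 <= E * w * 2 * b * ((2 * b + 1) * w - k - r - 2 * r * b).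
  by do ?apply: mulr_ge0; lra.
have : 0 <= 2 * r * k ^+ 2 * E by do ?apply: mulr_ge0; rewrite ?sqr_ge0; lra.
have : 0 <= 2 * b * k * w * (1 - E) by do ?apply: mulr_ge0; lra.
lra.
Qed.

Let scaled v := expR (2 * (b * (1 - expR (- v)) / r)) *
  ((b * expR (- v) - k) * expR (- (2 * b * v)) + 2^-1 * k * (2 * b * expR (- v) - k)).

Lemma gap_ge_param : 0 < r <= 1 / 3 -> 2^-1 < b < 1 -> r < b ->
  forall v v1, 0 <= v <= v1 -> expR (- v1) = 1 - r / b ->
  2^-1 <= scaled v1 -> 2^-1 <= scaled v.
Proof.
move=> hr hb rb v v1 hv ev1 fv1.
pose df v := expR (2 * (b * (1 - expR (- v)) / r)) * (b / r * expR (- v)) * slope v.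
have dfP (t : R) : is_derive t 1 scaled (df t).
  rewrite /scaled /df; apply: is_derive_eq.
  rewrite /GRing.scale /=; rewrite /slope.
  have -> : - ((2 * b + 1) * t) = - (k * t) - t - t by rewrite /k; ring.
  have -> : - (2 * b * t) = - (k * t) - t by rewrite /k; ring.
  rewrite !expRD /k; field; lra.
have pos t : 0 < expR (2 * (b * (1 - expR (- t)) / r)) * (b / r * expR (- t)).
  by do ?apply: mulr_gt0; rewrite ?expR_gt0 ?invr_gt0; lra.
apply: (@ge_endpoints scaled df slope 0 v1) => //.
- by move=> t _; rewrite /df pmulr_rgt0.
- by move=> t _; rewrite /df pmulr_rlt0.
- move=> s t s0 st tv1; apply: slope_mono => //.
  by rewrite -ev1 ler_expR; lra.
- rewrite /scaled !mulr0 !oppr0 expR0 subrr mulr0 mul0r mulr0 expR0 /k; lra.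
Qed.

Lemma gap_ge : 0 < r <= 1 / 3 -> 2^-1 < b < 1 -> r < b ->
  2^-1 * expR (- 2) - 2^-1 * k * (1 - 2 * r) <=
    (1 - b - r) * expR (2 * b * ln (1 - r / b)) ->
  forall y, 0 <= y <= 1 ->
  2^-1 * expR (- (2 * y)) - 2^-1 * k * (1 - 2 * (r * y)) <=
    (1 - b - r * y) * expR (2 * b * ln (1 - r * y / b)).
Proof.
move=> hr hb rb h1 y hy.
have w0 : 0 < 1 - r * y / b by rewrite subr_gt0 ltr_pdivrMr; nra.
have w1 : 0 < 1 - r / b by rewrite subr_gt0 ltr_pdivrMr; lra.
have wle : 1 - r / b <= 1 - r * y / b.
  by rewrite lerD2l lerN2 ler_pM2r ?invr_gt0; nra.
have e (u : R) : 0 < u -> expR (- - ln u) = u by move=> u0; rewrite opprK lnK.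
have := @gap_ge_param hr hb rb (- ln (1 - r * y / b)) (- ln (1 - r / b)).
rewrite /scaled !e // !mulrN !opprK.
have -> : b * (1 - (1 - r / b)) / r = 1 by field; lra.
have -> : b * (1 - (1 - r * y / b)) / r = y by field; lra.
have -> : b * (1 - r / b) = b - r by field; lra.
have -> : b * (1 - r * y / b) = b - r * y by field; lra.
have -> : 2 * b * (1 - r / b) = 2 * b - 2 * r by field; lra.
have -> : 2 * b * (1 - r * y / b) = 2 * b - 2 * (r * y) by field; lra.
rewrite expRN in h1 *; rewrite expRN => H.
have {}H := H _ erefl _.
have E2 := expR_gt0 (2 : R); have Ey := expR_gt0 (2 * y).
rewrite -subr_ge0.
rewrite -(pmulr_rge0 _ Ey) mulrBr mulrBr.
rewrite [expR (2 * y) * (_ * _^-1)]mulrCA divff ?gt_eqF // mulr1.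
have /H {}H : 0 <= - ln (1 - r * y / b) <= - ln (1 - r / b).
  rewrite lerN2 ler_ln ?posrE // wle andbT oppr_ge0 -ln1 ler_ln ?posrE //.
  by rewrite gerBl divr_ge0; nra.
have : 2^-1 <= expR (2 * y) *
     ((b - r * y - k) * expR (2 * b * ln (1 - r * y / b)) +
      2^-1 * k * (2 * b - 2 * (r * y) - k)).
  apply: H; rewrite mulr1.
  have e2 : expR 2 * (2^-1 * (expR 2)^-1) = 2^-1 :> R.
    by rewrite mulrCA divff ?mulr1 // lt0r_neq0.
  have := ler_wpM2l (ltW E2) h1; rewrite mulrBr e2 /k; lra.
rewrite /k; lra.
Qed.

End gap.
End analysis.

(** * The constants *)

Section constants_facts.
Context (R : realType).
Implicit Types r z s t y : R.

(** The definition of [h] solved for its power, with the bracket rearranged: the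
    right-hand side no longer contains the power. *)
Lemma hE z r : 0 < r < 2^-1 -> 0 < z < 2^-1 ->
  (h z r - z) * expR (2 * (1 - z) * ln (1 - r / (1 - z))) =
  (2^-1 - z) * (1 - 2 * r) - 2^-1 * expR (- 2).
Proof.
move=> hr hz.
have w0 : 0 < 1 - r / (1 - z) by rewrite subr_gt0 ltr_pdivrMr; lra.
have E0 := expR_gt0 (2 * (1 - z) * ln (1 - r / (1 - z))).
rewrite /h powRrM.
have -> : (1 - z) / (1 - z - r) = (1 - r / (1 - z))^-1 by field; lra.
rewrite -powRrM /powR gt_eqF ?invr_gt0 // lnV ?posrE // mulrN !expRN.
have E2 := expR_gt0 (2 : R).
set E := expR (2 * (1 - z) * _) in E0 *; set e := expR 2 in E2 *.
by field; lra.
Qed.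

(** Strict Bernoulli inequality for the exponent 2 (1 - z) > 1. *)
Lemma slope_lt1 z r : 0 < r < 2^-1 -> 0 < z < 2^-1 ->
  1 - 2 * r < expR (2 * (1 - z) * ln (1 - r / (1 - z))).
Proof.
move=> hr hz.
have w0 : 0 < 1 - r / (1 - z) by rewrite subr_gt0 ltr_pdivrMr; lra.
have w1 : 1 - r / (1 - z) < 1 by rewrite gtrBl divr_gt0; lra.
have k01 : 0 < (2 * (1 - z))^-1 < 1.
  by rewrite invr_gt0 invf_lt1 //; lra.
have u0 : 2 * (1 - z) * ln (1 - r / (1 - z)) != 0.
  by rewrite lt_eqF // pmulr_rlt0 ?ln_lt0 ?w0 //; lra.
have := expR_convex_lt k01 u0.
rewrite mulrA mulVf ?mul1r ?lnK ?posrE //; last lra.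
set E := expR _ => H.
have : (1 - r / (1 - z)) * (2 * (1 - z)) < ((2 * (1 - z))^-1 * E + (1 - (2 * (1 - z))^-1)) * (2 * (1 - z)).
  by rewrite ltr_pM2r //; lra.
have -> : (1 - r / (1 - z)) * (2 * (1 - z)) = 2 * (1 - z) - 2 * r by field; lra.
have -> : ((2 * (1 - z))^-1 * E + (1 - (2 * (1 - z))^-1)) * (2 * (1 - z)) = E + 2 * (1 - z) - 1 by field; lra.
lra.
Qed.

(** Let g be the point where the bracket of [h] vanishes, so that h g r = g. If
    z were below g, then h z r would be a weighted mean of z and g with positive
    weight on z, hence below h g r, against the maximality of z. *)
Lemma zstar_ge z r : 0 < r < 2^-1 -> is_zstar r z ->
  (2^-1 - z) * (1 - 2 * r) <= 2^-1 * expR (- 2).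
Proof.
move=> hr [hz zmax]; rewrite leNgt; apply/negP => lt.
pose g := 2^-1 - 2^-1 * expR (- 2) / (1 - 2 * r).
have E2 := expR_gt0 (- 2 : R).
have gE : (2^-1 - g) * (1 - 2 * r) = 2^-1 * expR (- 2) by rewrite /g; field; lra.
have gz : z < g by nra.
have hg : 0 < g < 2^-1.
  apply/andP; split; first lra.
  by rewrite /g gtrBl divr_gt0 //; nra.
have hh := hE hr hg; rewrite gE subrr in hh.
have Eg := expR_gt0 (2 * (1 - g) * ln (1 - r / (1 - g))).
have {}hh : h g r = g.
  move/eqP: hh; rewrite mulf_eq0 (gt_eqF Eg) orbF subr_eq0; exact: eqP.
have := zmax g hg; rewrite hh.
have := hE hr hz; have := slope_lt1 hr hz.
set E := expR (2 * _ * _); rewrite -gE => E1 hze gle.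
have E0 : 0 < E by lra.
have : (h z r - z) * E = (g - z) * (1 - 2 * r) by rewrite hze; ring.
have : (g - z) * E <= (h z r - z) * E by rewrite ler_pM2r //; lra.
have : (g - z) * (1 - 2 * r) < (g - z) * E by rewrite ltr_pM2l //; lra.
lra.
Qed.

Lemma expRN2_ge : 8^-1 <= expR (- 2) :> R.
Proof.
have e16 : 15 / 16 <= expR (- 16^-1) :> R.
  by apply: le_trans (expR_ge1Dx _); lra.
have -> : - 2 = (- 16^-1) *+ 32 :> R by lra.
rewrite -[_ *+ 32]mulr_natl expRM_natl.
apply: (@le_trans _ _ ((15 / 16) ^+ 32)); last by apply: lerXn2r; rewrite ?nnegrE ?expR_ge0 //; lra.
lra.
Qed.

(** By [zstar_ge] the bracket in [h] is nonnegative, so h z r <= z. *)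
Lemma rstar_le_zstar z r : 0 < r < 2^-1 -> is_zstar r z -> r <= h z r -> r <= z.
Proof.
move=> hr zs rh; have [hz _] := zs.
have := zstar_ge hr zs; rewrite -subr_le0 -hE // pmulr_lle0 ?expR_gt0 //; lra.
Qed.

(** For r > 1/3 the inequality r <= h z r reads (z - r) E >= exp (- 2) / 2 -
    (1/2 - z) (1 - 2 r), with E = (1 - r / b) ^ (2 b). Bernoulli bounds E by a
    product of two linear factors; then the left-hand side decreases with r and
    the right-hand side increases, which reduces the claim to r = 1/3 and to the
    negative discriminant of a quadratic polynomial. *)
Lemma rstar_le_third z r : 0 < r < 2^-1 -> is_zstar r z -> r <= h z r -> r <= 1 / 3.
Proof.
move=> hr zs rh; have [hz _] := zs; have rz := rstar_le_zstar hr zs rh.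
rewrite leNgt; apply/negP => r3.
pose b := 1 - z.
have hb : 2^-1 < b < 2 / 3 by rewrite /b; lra.
have w0 : 0 < 1 - r / b by rewrite subr_gt0 ltr_pdivrMr /b; lra.
have w1 : 1 - r / b < 1 by rewrite gtrBl divr_gt0 /b; lra.
have [k0 k1] : 0 < 2 * b - 1 /\ 2 * b - 1 < 1 by lra.
have bern : expR (2 * b * ln (1 - r / b)) <= (1 - r / b) * (1 - (2 * b - 1) * (r / b)).
  have -> : 2 * b * ln (1 - r / b) = ln (1 - r / b) + (2 * b - 1) * ln (1 - r / b) by ring.
  rewrite expRD lnK ?posrE // ler_pM2l //.
  have u0 : ln (1 - r / b) != 0 by rewrite lt_eqF // ln_lt0 // w0.
  have := @expR_convex_lt R (2 * b - 1) _ ltac:(lra) u0.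
  rewrite lnK ?posrE //; lra.
have := hE hr hz; rewrite -/b; set E := expR _ in bern * => he.
have E0 : 0 < E by exact: expR_gt0.
have e2 := expRN2_ge.
have hle : (r - z) * E <= (h z r - z) * E by rewrite ler_pM2r //; lra.
have y3 : 1 / 3 / b <= r / b by rewrite ler_pM2r ?invr_gt0; lra.
(* [y0] is the value of [y] at r = 1/3, and y0 * b = 1/3 *)
set y := r / b in bern w0 w1 y3.
set y0 := 1 / 3 / b in y3.
have b1 : (1 - y) * (1 - (2 * b - 1) * y) <= (1 - y0) * (1 - (2 * b - 1) * y0).
  apply: ler_pM; try nra.
have y0b : y0 * b = 1 / 3 by rewrite /y0; field; lra.
have y02 : y0 < 2 / 3 by rewrite /y0 ltr_pdivrMr; lra.
have y01 : 1 / 2 < y0 by rewrite /y0 ltr_pdivlMr; lra.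
have c1 : (z - r) * E <= (z - 1 / 3) * ((1 - y0) * (1 - (2 * b - 1) * y0)).
  apply: ler_pM; try lra.
have c2 : 16^-1 - (2^-1 - z) / 3 <= (z - 1 / 3) * ((1 - y0) * (1 - (2 * b - 1) * y0)) by nra.
have c3 : 0 <= (2 / 3 - b) * (1 - y0) * (1 / 3 + y0) + b / 3 - 11 / 48.
  have -> : b = 1 - z by [].
  have : (2 * b - 1) * y0 = 2 / 3 - y0 by lra.
  move=> e; move: c2; rewrite e /b; lra.
have : 0 <= ((2 / 3 - b) * (1 - y0) * (1 / 3 + y0) + b / 3 - 11 / 48) * y0.
  by apply: mulr_ge0; lra.
have -> : ((2 / 3 - b) * (1 - y0) * (1 / 3 + y0) + b / 3 - 11 / 48) * y0 =
  (2 / 3 * y0 - y0 * b) * (1 - y0) * (1 / 3 + y0) + (y0 * b) / 3 - 11 / 48 * y0 by ring.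
rewrite y0b.
have -> : (2 / 3 * y0 - 1 / 3) * (1 - y0) * (1 / 3 + y0) + 1 / 3 / 3 - 11 / 48 * y0
  = - (y0 * (2 / 3 * (y0 - 7 / 12) ^+ 2 + (11 / 48 - 49 / 216))) by field.
rewrite oppr_ge0 leNgt => /negP; apply; apply: mulr_gt0; first lra.
by have := sqr_ge0 (y0 - 7 / 12); lra.
Qed.

(** The right-hand side decreases in
    the small load [s]; in the tiny load [t] either it
    decreases too, or it equals [z], which is enough. So the worst case is that
    both loads sit at the thresholds of type A, and there [gap_ge] applies. *)
Lemma large_small_bound z r y s t : 0 < r < 2^-1 -> is_zstar r z -> r <= h z r ->
  0 <= y <= 1 ->
  s <= - 2^-1 * ln (1 - 2 * (r * y)) ->
  t <= - (1 - z) * ln (1 - r * y / (1 - z)) ->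
  r * y <= z - Num.max 0 (expR (- (2 * (s - t))) *
     (2^-1 * expR (- (2 * (y - s))) - (2^-1 - z))).
Proof.
move=> hr zs rh hy hs ht.
have [hz _] := zs.
have rz := rstar_le_zstar hr zs rh; have r3 := rstar_le_third hr zs rh.
have ry : r * y <= z by nra.
rewrite lerBrDl -lerBrDr ge_max subr_ge0 ry /=.
have w0 : 0 < 1 - r * y / (1 - z) by rewrite subr_gt0 ltr_pdivrMr; nra.
have q0 : 0 < 1 - 2 * (r * y) by nra.
have -> : expR (- (2 * (s - t))) * (2^-1 * expR (- (2 * (y - s))) - (2^-1 - z)) =
  expR (2 * t) * (2^-1 * expR (- (2 * y)) - (2^-1 - z) * expR (- (2 * s))).
  have -> : - (2 * (s - t)) = 2 * t - 2 * s by ring.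
  have -> : - (2 * (y - s)) = - (2 * y) + 2 * s by ring.
  have e1 : expR (2 * s) * expR (- (2 * s)) = 1 by rewrite -expRD subrr expR0.
  have alg (T M Y S c : R) : S * M = 1 ->
      T * M * (2^-1 * (Y * S) - c) = T * (2^-1 * Y - c * M).
    move=> e.
    have -> : T * M * (2^-1 * (Y * S) - c) = 2^-1 * T * Y * (S * M) - c * T * M by ring.
    by rewrite e; ring.
  by rewrite !expRD; apply: alg.
have es : 1 - 2 * (r * y) <= expR (- (2 * s)).
  rewrite -[leLHS]lnK ?posrE // ler_expR; lra.
have et : expR (2 * t) * expR (2 * (1 - z) * ln (1 - r * y / (1 - z))) <= 1.
  by rewrite -expRD -[leRHS]expR0 ler_expR; lra.
have hb : 2^-1 < 1 - z < 1 by lra.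
have hr3 : 0 < r <= 1 / 3 by lra.
have h1 : 2^-1 * expR (- 2) - 2^-1 * (2 * (1 - z) - 1) * (1 - 2 * r) <=
    (1 - (1 - z) - r) * expR (2 * (1 - z) * ln (1 - r / (1 - z))).
  have := hE hr hz; set E := expR _ => he.
  have : (r - z) * E <= (h z r - z) * E.
    by rewrite ler_pM2r ?expR_gt0 //; lra.
  rewrite he; lra.
have := gap_ge hr3 hb ltac:(lra) h1 hy.
set E := expR (2 * (1 - z) * _) in et * => gap.
have T0 := expR_gt0 (2 * t); have E0 : 0 < E by exact: expR_gt0.
have zz : 0 < 2^-1 - z by lra.
apply: le_trans (_ : expR (2 * t) * (2^-1 * expR (- (2 * y)) - (2^-1 - z) * (1 - 2 * (r * y))) <= _).
  by rewrite ler_pM2l // lerD2l lerN2 ler_pM2l.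
apply: le_trans (_ : expR (2 * t) * ((z - r * y) * E) <= _).
  rewrite ler_pM2l //; lra.
rewrite mulrCA -[leRHS]mulr1 ler_wpM2l //; lra.
Qed.

End constants_facts.

(** * Expected allocation for the two types of resources *)

Section allocation_bounds.
Context (R : realType) (m n : nat) (I : instance R m n).
Context (r z : R) (x : 'I_n -> 'I_m -> R).
Context d (Omega : measurableType d) (P : probability Omega R).
Context (X : Omega -> seq (customer R m n)).
Context d' (Z : measurableType d') (seed : Omega -> Z) (share : sharing_rule R m n Z).
Hypothesis orderedX : arrivals_ordered I X.
Hypothesis measX : stream_measurable X.
Hypothesis poissonX : poisson_arrivals I P X.
Hypothesis mseed : measurable_fun setT seed.
Hypothesis routX : routing_independent I x P X seed.
Hypothesis share_valid : sharing_rule_valid share.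
Hypothesis share_meas : sharing_rule_measurable share.
Hypothesis feasible : LP_feasible I x.
Variable j : 'I_m.

Local Notation u i := (usage I i j).
Local Notation c := (capacity I j).
Local Notation used := (used I r z x X seed share j).
Local Notation fill := (fill_prob I r z x P X seed share j).
Local Notation allocation := (\int[P]_w RLS I r z x share (seed w) (X w) j).

Let x_ge0 i k : 0 <= x i k.
Proof. by case: feasible => _ _; exact. Qed.

Let u_ge0 i : 0 <= u i.
Proof. by have /andP[] := usage_bounds I i j. Qed.

Let c_gt0 : 0 < c.
Proof. exact: capacity_gt0. Qed.

Let used_itv tau w : 0 <= used tau w <= c.
Proof. by rewrite RLS_ge0 // RLS_le_capacity. Qed.

Lemma bounded_rv_used tau : bounded_rv (used tau).
Proof.
split; first exact: measurable_used.
by exists c => w; have /andP[h0 h1] := used_itv tau w; rewrite ger0_norm.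
Qed.

(** The mean number of customers of type [i] routed to [j] in the window number
    [l]. *)
Definition weight (tau : nat -> R) l i : R :=
  mean_arrivals I i (window I (tau l) (tau l.+1)) * (x i j / Lambda I i).

Let window_sub (a b : R) : window I a b `<=` `[0, horizon I].
Proof. by move=> y [[]]. Qed.

Let Lambda_ge0 i : 0 <= Lambda I i.
Proof. exact: mean_arrivals_ge0. Qed.

Lemma weight_ge0 tau l i : 0 <= weight tau l i.
Proof. by apply: mulr_ge0; [exact: mean_arrivals_ge0|exact: divr_ge0]. Qed.

Lemma sum_weight q tau i : tau 0%N < 0 -> horizon I <= tau q ->
  (forall l, (l < q)%N -> tau l <= tau l.+1) ->
  \sum_(l < q) weight tau l i = x i j.
Proof.
move=> t0 tq tmono; rewrite -big_distrl /=.
have -> : \sum_(l < q) mean_arrivals I i (window I (tau l) (tau l.+1)) = Lambda I i.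
  have s0 : mean_arrivals I i (span I (tau 0%N)) = 0.
    by rewrite span_neg // mean_arrivals_set0.
  rewrite /Lambda -(span_full tq).
  elim: q tmono {tq} => [|q IH] tmono; first by rewrite big_ord0 s0.
  rewrite big_ord_recr /= IH; last by move=> l lq; apply: tmono; exact: ltnW.
  by rewrite -mean_window //; exact: tmono.
have [L0|L0] := eqVneq (Lambda I i) 0; last by rewrite mulrC divfK.
rewrite L0 mul0r; apply/eqP; rewrite eq_le x_ge0 /=.
have [_ /(_ i) + _] := feasible; rewrite L0; apply: le_trans.
by rewrite (bigD1 j) //= lerDl; exact: sumr_ge0.
Qed.

Lemma single_prob_ge_weight delta tau l i :
  mass I (window I (tau l) (tau l.+1)) <= delta ->
  expR (- delta) * weight tau l i <= single_prob I x (tau l) (tau l.+1) i j.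
Proof.
move=> hm; rewrite /single_prob /weight /= -mulrA mulrCA ler_wpM2l ?mean_arrivals_ge0 //.
by rewrite ler_wpM2r ?divr_ge0 // ler_expR lerN2.
Qed.

Lemma sum_weighted q tau (Q : {set 'I_n}) (g : 'I_n -> R) : tau 0%N < 0 -> horizon I <= tau q ->
  (forall l, (l < q)%N -> tau l <= tau l.+1) ->
  \sum_(l < q) \sum_(i in Q) g i * weight tau l i = \sum_(i in Q) g i * x i j.
Proof.
move=> t0 tq tmono; rewrite exchange_big /=; apply: eq_bigr => i _.
by rewrite -big_distrr /= sum_weight.
Qed.

Lemma allocationE tau : horizon I <= tau -> \int[P]_w used tau w = allocation.
Proof. by move=> Tt; apply: eq_Rintegral => w _; exact: used_full. Qed.

Lemma used_neg_int tau : tau < 0 -> \int[P]_w used tau w = 0.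
Proof.
move=> t0; transitivity (\int[P]_w (0 * \1_setT w : R)); last by rewrite Rintegral_indic // mul0r.
by apply: eq_Rintegral => w _; rewrite mul0r; exact: used_neg.
Qed.

Lemma fill_prob_neg tau b : tau < 0 -> 0 <= b -> fill tau b = 1.
Proof.
move=> t0 b0; rewrite /fill_prob (_ : mkset _ = setT) ?probability_setT //.
by apply/seteqP; split=> w //= _; rewrite used_neg.
Qed.

Lemma fill_ge0 tau b : 0 <= fill tau b.
Proof. exact: fine_ge0. Qed.

(** Customers of [Q] fit whenever at most [b] is in use, and by Markov's
    inequality this has probability at least one minus the expected use over [b]. *)
Lemma allocation_fill (b delta : R) (Q : {set 'I_n}) : 0 < b -> 0 < delta ->
  (forall i, i \in Q -> admissible I r z x i j) ->
  (forall i, i \in Q -> u i <= c - b) ->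
  b * (1 - expR (- (expR (- delta) * (\sum_(i in Q) u i * x i j) / b))) <= allocation.
Proof.
move=> b0 d0 Qadm Qfit.
have [q [tau [t0 tq tmono tmass]]] := fine_partition I d0.
rewrite -(allocationE tq) -(sum_weighted Q _ t0 tq tmono).
apply: (@fill_recursion R b (expR (- delta)) q (fun l => \int[P]_w used (tau l) w)
  (fun l => fill (tau l) b) (fun l => \sum_(i in Q) u i * weight tau l i)) => //.
- by move=> l; apply: sumr_ge0 => i _; apply: mulr_ge0 => //; exact: weight_ge0.
- by rewrite used_neg_int.
- by move=> l; exact: fill_ge0.
- by move=> l; apply: markov_le => //; [exact: bounded_rv_used|move=> w; have /andP[] := used_itv (tau l) w].
move=> l lq.
apply: le_trans (process_step (f := id) (M := c) (b := b) (Q := Q) (g := fun i => u i)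
  orderedX measX poissonX mseed routX share_valid share_meas x_ge0 (tmono l lq) _ _ _ _) => //.
- rewrite lerD2l; apply: ler_wpM2l; first exact: fill_ge0.
  rewrite big_distrr /=; apply: ler_sum => i _; rewrite mulrCA.
  by apply: ler_wpM2l => //; apply: single_prob_ge_weight; exact: tmass.
- by move=> y /andP[y0 y1]; rewrite ger0_norm.
- by move=> w; apply: used_le => //; exact: tmono.
- move=> i w iQ ub Sw; rewrite /= (used_single Sw) ?Qadm //.
  by have := Qfit i iQ; lra.
Qed.

(** [process_step] for the use plus the value [c * V] of an unused resource. This
    quantity never decreases because [V <= z] while the first customer, shared or
    not, uses at least [z * c]; a routed customer of type [i] raises it by
    [u i - c * V]. *)
Lemma allocation_stop (delta : R) : 0 < delta -> 0 < z < 2^-1 ->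
  ~~ type_A I r z x j ->
  c * floor_value z (expR (- delta))
    ((\sum_(i in medium I z j) u i * x i j) / c) ((\sum_(i in large I j) u i * x i j) / c)
  <= allocation.
Proof.
move=> d0 hz nA.
have z2 : z <= 2^-1 by lra.
have [q [tau [t0 tq tmono tmass]]] := fine_partition I d0.
rewrite -(allocationE tq) -!(sum_weighted _ _ t0 tq tmono) !big_distrl /=.
rewrite mulrC -ler_pdivlMr //.
pose mm l := (\sum_(i in medium I z j) u i * weight tau l i) / c.
pose ww l := (\sum_(i in large I j) u i * weight tau l i) / c.
have := @stopping_recursion R z (expR (- delta)) q (fun l => (\int[P]_w used (tau l) w) / c)
  (fun l => fill (tau l) 0) mm ww hz (expR_ge0 _) _ _ _ _.
rewrite used_neg_int // fill_prob_neg // mul0r add0r mul1r; apply.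
- by move=> l; apply: divr_ge0; [apply: sumr_ge0 => i _; apply: mulr_ge0 => //; exact: weight_ge0|exact: ltW].
- by move=> l; apply: divr_ge0; [apply: sumr_ge0 => i _; apply: mulr_ge0 => //; exact: weight_ge0|exact: ltW].
- by move=> l; exact: fill_ge0.
move=> l V lq /andP[V0 Vz].
pose f (y : R) := y + c * V * \1_[set y | y <= 0] y.
have mneg : measurable [set y : R | y <= 0] by rewrite -set_itvNyc.
have fE t : \int[P]_w f (used t w) = \int[P]_w used t w + c * V * fill t 0.
  have mA : measurable [set w | used t w <= 0] by exact: measurable_used_le.
  have [_ e] := Rintegral_add_indics P [:: tt] (fun=> c * V) (bounded_rv_used t)
    (A := fun=> [set w | used t w <= 0]) (fun=> mA).
  rewrite big_seq1 in e; rewrite -e; apply: eq_Rintegral => w _.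
  by rewrite big_seq1 /f !indicE; congr (_ + _ * _%:R); congr nat_of_bool; rewrite !inE.
have cV0 : 0 <= c * V by rewrite mulr_ge0 // ltW.
have Vzc : c * V <= z * c by rewrite mulrC ler_pM2r.
have fpos y : 0 < y -> f y = y.
  by move=> y0; rewrite /f indicE memNset ?mulr0 ?addr0 //= leNgt y0.
have f0 : f 0 = c * V by rewrite /f indicE mem_set /= ?mulr1 ?add0r.
have gap t w := @RLS_gap R m n I r z x d' Z share share_valid (seed w) (upto t (X w)) j z2 nA.
have zc0 : 0 < z * c by apply: mulr_gt0 => //; lra.
have inQ i : i \in medium I z j :|: large I j -> z * c <= u i.
  by move=> iQ; apply: (admissible_usage_ge (x := x) (r := r)) => //; rewrite /admissible iQ orbT.
have mf : measurable_fun setT f.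
  by apply: measurable_funD => //; apply: measurable_funM => //; exact: measurable_indic.
have fM y : 0 <= y <= c -> `|f y| <= c + c * V.
  move=> /andP[y0 yc]; rewrite /f indicE.
  have i0 : 0 <= (y \in [set y | y <= 0])%:R :> R by [].
  have i1 : (y \in [set y | y <= 0])%:R <= 1 :> R by case: (_ \in _).
  by rewrite ger0_norm; nra.
have mono w : f (used (tau l) w) <= f (used (tau l.+1) w).
  have le : used (tau l) w <= used (tau l.+1) w by apply: used_le => //; exact: tmono.
  have ge0 : 0 <= used (tau l) w by have /andP[] := used_itv (tau l) w.
  have [e|pos] := gap (tau l.+1) w.
    have e1 : used (tau l.+1) w = 0 := e.
    by have -> : used (tau l) w = used (tau l.+1) w by lra.
  have pos' : z * c <= used (tau l.+1) w := pos.
  rewrite [leRHS]fpos; last lra.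
  have [a0|apos] := leP (used (tau l) w) 0; last by rewrite fpos.
  by have -> : used (tau l) w = 0; [lra|rewrite f0; lra].
have jump i w : i \in medium I z j :|: large I j -> used (tau l) w <= 0 ->
    single_arrival X (tau l) (tau l.+1) i j w ->
    f (used (tau l) w) + (u i - c * V) <= f (used (tau l.+1) w).
  move=> iQ ub Sw; have /andP[ug _] := used_itv (tau l) w.
  have u0 : used (tau l) w = 0 by apply/eqP; rewrite eq_le ub ug.
  have ui := inQ i iQ.
  rewrite (used_single Sw) ?u0 ?subr0 ?add0r ?f0; last first.
  - by have /andP[] := usage_bounds I i j.
  - by rewrite /admissible iQ orbT.
  have upos : 0 < u i by apply: lt_le_trans ui.
  by rewrite [leRHS]fpos // addrC subrK.
have := process_step orderedX measX poissonX mseed routX share_valid share_meas x_ge0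
  (tmono l lq) mf fM mono jump.
rewrite !fE => step.
suff hsum : c * (expR (- delta) * (2 * (z - V) * mm l + (1 - 2 * V) * ww l)) <=
  \sum_(i in medium I z j :|: large I j)
    (u i - c * V) * single_prob I x (tau l) (tau l.+1) i j.
  have H := ler_wpM2l (fill_ge0 (tau l) 0) hsum.
  rewrite -(ler_pM2r c_gt0) mulrDl [X in _ <= X]mulrDl !divfK ?gt_eqF //; lra.
apply: (@le_trans _ _ (expR (- delta) * \sum_(i in medium I z j :|: large I j)
    (u i - c * V) * weight tau l i)); last first.
  rewrite big_distrr /=; apply: ler_sum => i iQ; rewrite mulrCA.
  apply: ler_wpM2l; first by have := inQ i iQ; lra.
  by apply: single_prob_ge_weight; exact: tmass.
rewrite mulrCA ler_wpM2l ?expR_ge0 //.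
rewrite (big_setID (large I j)) /= addrC.
have -> : ((medium I z j :|: large I j) :&: large I j = large I j)%SET.
  by apply/setP => i; rewrite !inE; case: (_ < _); rewrite ?orbT ?andbF.
have -> : ((medium I z j :|: large I j) :\: large I j = medium I z j)%SET.
  by apply/setP => i; rewrite !inE; case: (_ < _); rewrite ?andbF ?andbT ?orbF.
have -> : c * (2 * (z - V) * mm l + (1 - 2 * V) * ww l) =
   \sum_(i in medium I z j) 2 * (z - V) * (u i * weight tau l i) +
   \sum_(i in large I j) (1 - 2 * V) * (u i * weight tau l i).
  by rewrite -!big_distrr /= /mm /ww; field; rewrite gt_eqF.
(* u - c V >= 2 (z - V) u if z c <= u <= c / 2, and u - c V >= (1 - 2 V) u if
   u > c / 2 *)
apply: lerD; apply: ler_sum => i; rewrite !inE mulrA => hi; apply: ler_wpM2r; rewrite ?weight_ge0 //.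
  by case/andP: hi; rewrite -leNgt => h1 h2; nra.
by have : c / 2 < u i := hi; nra.
Qed.

(** The factor expR (- delta) accounts for windows with several arrivals; it
    tends to 1 as the windows shrink. *)
Lemma rate_limit (F : R -> R) : continuous F ->
  (forall delta, 0 < delta -> F (expR (- delta)) <= allocation) -> F 1 <= allocation.
Proof.
move=> cF FC; apply: le_left_limit => // t /andP[t0 t1].
rewrite -[t]lnK ?posrE // -[ln t]opprK; apply: FC.
by rewrite oppr_gt0 ln_lt0 // t0.
Qed.

Lemma allocation_fill_limit (b : R) (Q : {set 'I_n}) : 0 < b ->
  (forall i, i \in Q -> admissible I r z x i j) ->
  (forall i, i \in Q -> u i <= c - b) ->
  b * (1 - expR (- ((\sum_(i in Q) x i j * u i) / b))) <= allocation.
Proof.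
move=> b0 Qadm Qfit; set V := \sum_(i in Q) x i j * u i.
have bn0 : b != 0 by rewrite gt_eqF.
suff : (fun e : R => b * (1 - expR (- (e * V / b)))) 1 <= allocation by rewrite mul1r.
apply: (rate_limit (@fill_continuous R b V bn0)).
move=> delta d0; have -> : V = \sum_(i in Q) u i * x i j.
  by apply: eq_bigr => i _; rewrite mulrC.
exact: allocation_fill.
Qed.

Lemma allocation_stop_limit : 0 < z < 2^-1 -> ~~ type_A I r z x j ->
  c * (z - Num.max 0 (expR (- (2 * (load_on I x (medium I z j) j / c))) *
    (2^-1 * expR (- (2 * (load_on I x (large I j) j / c))) - (2^-1 - z)))) <= allocation.
Proof.
move=> hz nA; set M := load_on _ _ _ _ / c; set W := load_on _ _ _ _ / c.
have stop delta : 0 < delta -> c * floor_value z (expR (- delta)) M W <= allocation.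
  move=> d0; have := allocation_stop d0 hz nA.
  have -> : \sum_(i in medium I z j) u i * x i j = load_on I x (medium I z j) j.
    by apply: eq_bigr => i _; rewrite mulrC.
  have -> : \sum_(i in large I j) u i * x i j = load_on I x (large I j) j.
    by apply: eq_bigr => i _; rewrite mulrC.
  exact.
have [zle|zgt] := leP (c * z) allocation.
  by apply: le_trans zle; rewrite ler_pM2l // gerBl le_max lexx.
have lim : c * (z - floor_gap z M W 1) <= allocation.
  apply: (rate_limit (@floor_gap_continuous R z M W c)) => delta /stop.
  rewrite /floor_value.
  have [g0|//] := leP (floor_gap z M W (expR (- delta))) 0.
  by rewrite subr0 leNgt zgt.
apply: le_trans lim; rewrite ler_pM2l // lerD2l lerN2 /floor_gap !mul1r.
by rewrite le_max lexx orbT.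
Qed.

End allocation_bounds.

(** * The competitive ratio *)

Lemma expectation_Rintegral (R : realType) d (Omega : measurableType d)
    (P : probability Omega R) (f : Omega -> R) : bounded_rv f ->
  'E_P[f]%E = (\int[P]_w f w)%:E.
Proof.
move=> bf; rewrite unlock /Rintegral fineK //.
apply: integrable_fin_num => //; exact: bounded_rv_integrable.
Qed.

Lemma rstarP (R : realType) (r z : R) : is_rstar r -> is_zstar r z ->
  0 < r < 2^-1 /\ r <= h z r.
Proof.
move=> [[hr [v [[z' hz' <-] _] rv]] _] [_ zmax]; split=> //.
by apply: le_trans rv _; apply: zmax; move: hz'; rewrite /= in_itv.
Qed.

Lemma US_UT_loads (R : realType) (m n : nat) (I : instance R m n) (z : R)
    (x : 'I_n -> 'I_m -> R) (j : 'I_m) :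
  load_on I x (medium I z j) j = US I x j - UT I z x j /\
  load_on I x (large I j) j = U I x j - US I x j.
Proof.
split.
  rewrite /US /UT /load_on [\sum_(i in small I j) _](big_setID (medium I z j)) /=.
  have -> : (small I j :&: medium I z j = medium I z j)%SET.
    by apply/setP => i; rewrite !inE; case: (_ < _).
  have -> : (small I j :\: medium I z j = tiny I z j)%SET.
    by apply/setP => i; rewrite !inE (ltNge _ (z * _)); case: (_ < _); rewrite ?andbF ?andbT.
  by rewrite addrK.
rewrite /U /US /load_on [\sum_(i in [set: 'I_n]%SET) _](big_setID (large I j)) /= finset.setTI.
have -> : ([set: 'I_n] :\: large I j = small I j)%SET.
  by apply/setP => i; rewrite !inE andbT.
by rewrite addrK.
Qed.

Theorem theorem3 (R : realType) (m n : nat) (I : instance R m n)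
    (rstar zstar : R) (x : 'I_n -> 'I_m -> R)
    (d : measure_display) (Omega : measurableType d) (P : probability Omega R)
    (X : Omega -> seq (customer R m n))
    (d' : measure_display) (Z : measurableType d') (seed : Omega -> Z)
    (share : sharing_rule R m n Z) :
  is_rstar rstar ->
  is_zstar rstar zstar ->
  LP_optimal I x ->
  arrivals_ordered I X ->
  stream_measurable X ->
  poisson_arrivals I P X ->
  measurable_fun setT seed ->
  routing_independent I x P X seed ->
  sharing_rule_valid share ->
  sharing_rule_measurable share ->
  forall j : 'I_m,
    ((rstar * U I x j)%:E <=
       'E_P[fun w => RLS I rstar zstar x share (seed w) (X w) j])%E.
Proof.
set r := rstar; set z := zstar.
move=> rs zs [feas _] orderedX measX poissonX mseed routX valid meas j.
have [hr rh] := rstarP rs zs; have [hz _] := zs.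
have bA : bounded_rv (fun w => RLS I r z x share (seed w) (X w) j).
  have -> : (fun w => RLS I r z x share (seed w) (X w) j) =
      used I r z x X seed share j (horizon I).
    by apply/funext => w; rewrite used_full.
  exact: bounded_rv_used.
rewrite expectation_Rintegral // lee_fin.
set c := capacity I j; have c0 : 0 < c by exact: capacity_gt0.
set y := U I x j / c.
have Uc : U I x j = y * c by rewrite /y divfK // gt_eqF.
have hy : 0 <= y <= 1.
  have [cap _ x0] := feas; rewrite /y ler_pdivrMr // mul1r; apply/andP; split.
    apply: divr_ge0; last exact: ltW.
    apply: sumr_ge0 => i _; apply: mulr_ge0 => //.
    by have /andP[] := usage_bounds I i j.
  apply: le_trans (cap j); rewrite le_eqVlt; apply/orP; left; apply/eqP.
  by apply: eq_bigl => i; rewrite inE.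
have fill := allocation_fill_limit orderedX measX poissonX mseed routX valid meas feas (j := j)
  (r := r) (z := z).
have q0 : 0 < 1 - 2 * (r * y) by nra.
have w0 : 0 < 1 - r * y / (1 - z) by rewrite subr_gt0 ltr_pdivrMr; nra.
have rUc : 2 * r * U I x j / c = 2 * (r * y) by rewrite /y; ring.
have rUcz : r * U I x j / (c * (1 - z)) = r * y / (1 - z).
  by rewrite /y; field; lra.
case: (boolP (type_A I r z x j)) => [tA|nA].
  have adm i : admissible I r z x i j by rewrite /admissible tA.
  have conclude (b V q : R) : 0 < b -> 0 < q -> - b * ln q <= V ->
      b * (1 - q) <= b * (1 - expR (- (V / b))).
    move=> b0 qq hV; rewrite ler_pM2l // lerD2l lerN2 -[leRHS]lnK ?posrE // ler_expR.
    rewrite lerNl ler_pdivlMr //; lra.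
  case/orP: tA; rewrite -/c ?rUc ?rUcz => hV.
    have b0 : 0 < c / 2 by lra.
    apply: le_trans (fill (c / 2) (small I j) b0 _ _) => //; last first.
      by move=> i; rewrite !inE -leNgt -/c; lra.
    apply: le_trans (conclude (c / 2) _ (1 - 2 * (r * y)) b0 q0 _); first by rewrite Uc; lra.
    by move: hV; rewrite /US /load_on; lra.
  have b0 : 0 < c * (1 - z) by apply: mulr_gt0 => //; lra.
  apply: le_trans (fill (c * (1 - z)) (tiny I z j) b0 _ _) => //; last first.
    by move=> i; rewrite !inE -/c => /andP[_]; lra.
  apply: le_trans (conclude (c * (1 - z)) _ (1 - r * y / (1 - z)) b0 w0 _).
    rewrite Uc le_eqVlt; apply/orP; left; apply/eqP; field; lra.
  by move: hV; rewrite /UT /load_on; lra.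
apply: le_trans (allocation_stop_limit orderedX measX poissonX mseed routX valid meas feas hz nA).
have [-> ->] := US_UT_loads I z x j; rewrite -/c.
move: nA; rewrite /type_A negb_or -!ltNge -/c rUc rUcz => /andP[hS hT].
set s := US I x j / c; set t := UT I z x j / c.
have hs : s <= - 2^-1 * ln (1 - 2 * (r * y)).
  by rewrite /s ler_pdivrMr // mulrAC ltW.
have ht : t <= - (1 - z) * ln (1 - r * y / (1 - z)).
  by rewrite /t ler_pdivrMr // mulrAC ltW.
have := large_small_bound hr zs rh hy hs ht.
rewrite !mulrBl -/s -/t -/y Uc => H.
by rewrite mulrA [leRHS]mulrC ler_pM2r.
Qed.
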